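(* Let $T\subset\mathbb{R}^2$ be a topologist's sine curve and let $\gamma_n$ ($n\in\mathbb{N}$) be an allowable sequence of approximations of $T$ contained in one of the two components of $\mathbb{R}^2\setminus T$. Let $(\gamma_n)_t$ denote the evolution of $\gamma_n$ by curve shortening flow. Then for each $t>0$ $$\sup_{n\in\mathbb{N}}\mathcal{L}\big((\gamma_n)_t\big)<\infty .$$
   Context: Topologist's sine curve: $T$ is the union of (i) the graph of $y=\sin(1/x)$ for $x\in(0,\beta)$ for some $\beta>0$, (ii) the vertical segment $V=\{0\}\times[-1,1]$, and (iii) a smooth arc, disjoint from the first two pieces except at its endpoints, connecting the end of the graph at $x=\beta$ back to $V$. Its complement has two components; $\Omega$ denotes the bounded one, so $T=\partial\Omega$. Allowable approximations (inside $\Omega$): a sequence of smooth closed curves $\gamma_n$ such that (1) $\gamma_n\subset\Omega$; (2) the regions bounded by $\gamma_n$ form an increasing sequence of sets; (3) $d_H(\gamma_n,T)\to0$ as $n\to\infty$, where $d_H$ is the Hausdorff distance; (4) for any $\epsilon>0$, outside the $\epsilon$-neighbourhood $B_\epsilon(V)$ of $V$ the curves $\gamma_n$ converge smoothly to $T\setminus B_\epsilon(V)$; (5) there exists a positive integer $\omega$ such that each $\gamma_n$ is an $\omega$-graph, meaning that $\gamma_n$ intersects each vertical line at most $\omega$ times. Allowable approximations in $\mathbb{R}^2\setminus\overline{\Omega}$ are defined similarly, with $\gamma_n\subset\mathbb{R}^2\setminus\overline{\Omega}$ smooth closed curves around $\overline{\Omega}$ whose bounded regions decrease. (In the paper, conclusions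 about $\gamma_n$ are understood after discarding finitely many $n$.) Curves evolve by curve shortening flow: $\frac{\partial}{\partial t}x=\vec{H}(x)$, with $\vec H$ the curvature vector; after its extinction time the evolution of a closed curve is the empty set. $\mathcal{L}$ denotes length. *)

(* Defs.v *)
From HB Require Import structures.
From mathcomp Require Import all_boot all_order all_algebra.
From mathcomp Require Import all_classical all_reals all_analysis.

Set Implicit Arguments.
Unset Strict Implicit.
Unset Printing Implicit Defensive.

Import Order.TTheory GRing.Theory Num.Theory.
Import numFieldNormedType.Exports.

Local Open Scope ring_scope.
Local Open Scope classical_set_scope.

Section Plane.
Context {R : realType}.
Implicit Types (A B T : set (R * R)) (p q : R * R).

(* The library norm of [R * R] is the max norm: it gives the right topology,
   bounded sets and derivatives, but not Euclidean lengths and distances. *)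
Definition eucl_norm p : R := Num.sqrt (p.1 ^+ 2 + p.2 ^+ 2).

Definition eucl_dist p q : R := eucl_norm (p - q).

Definition eucl_nbhd (e : R) A : set (R * R) :=
  [set p | exists2 q, A q & eucl_dist p q < e].

Definition hausdorff_dist A B : \bar R :=
  Order.max
    (ereal_sup [set ereal_inf [set (eucl_dist p q)%:E | q in B] | p in A])
    (ereal_sup [set ereal_inf [set (eucl_dist p q)%:E | p in A] | q in B]).

(* The union of the bounded components of the complement of [A]; for a Jordan
   curve or a topologist's sine curve there is exactly one of them. *)
Definition bounded_region A : set (R * R) :=
  [set p | ~ A p /\ bounded_set (connected_component (~` A) p)].

Definition smooth_curve (c : R -> R * R) : Prop :=
  forall (k : nat) (u : R), derivable (c^`(k)) u 1.

Definition smooth_fun (f : R -> R) : Prop :=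
  forall (k : nat) (u : R), derivable (f^`(k)) u 1.

(* Smooth closed curves are regular, simple and parametrized on R / Z. *)
Definition smooth_closed_curve (c : R -> R * R) : Prop :=
  [/\ smooth_curve c,
      forall u, c^`() u != 0,
      forall u, c (u + 1) = c u
    & {in `[0, 1[ &, injective c}].

Definition speed (c : R -> R * R) (u : R) : R := eucl_norm (c^`() u).

Definition curve_length (c : R -> R * R) : \bar R :=
  (\int[lebesgue_measure]_(u in `[0%R, 1%R]) (speed c u)%:E)%E.

Definition unit_tangent (c : R -> R * R) (u : R) : R * R :=
  (speed c u)^-1 *: c^`()%classic u.

(* The derivative of the unit tangent with respect to arclength. *)
Definition curvature_vector (c : R -> R * R) (u : R) : R * R :=
  (speed c u)^-1 *: (unit_tangent c)^`()%classic u.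

(* [f] is of class C^k on the open set [U]: all iterated partial derivatives
   of order at most [k] exist and are continuous on [U]. *)
Fixpoint Ck_on (k : nat) (U : set (R * R)) (f : R * R -> R * R) : Prop :=
  (forall p, U p -> {for p, continuous f}) /\
  if k is k'.+1 then
    [/\ forall p, U p -> derivable f p (1, 0) /\ derivable f p (0, 1),
        Ck_on k' U ('D_(1, 0) f)
      & Ck_on k' U ('D_(0, 1) f)]
  else True.

(* On a set which is not open, smooth means: having a smooth extension to an
   open neighbourhood. *)
Definition smooth_on (D : set (R * R)) (f : R * R -> R * R) : Prop :=
  exists U g, [/\ open U, D `<=` U, forall k, Ck_on k U g
                & {in D, f =1 g}].

(* [X t u] is the position at time [t] of the point of parameter [u]; only the
   times in [0, tau[ are relevant. *)
Definition csf_solution (c : R -> R * R) (tau : R) (X : R -> R -> R * R) :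
    Prop :=
  [/\ 0 < tau,
      X 0 = c,
      smooth_on (`[0, tau[ `*` [set: R]) (fun tu => X tu.1 tu.2),
      forall t : R, 0 <= t < tau -> smooth_closed_curve (X t)
    & forall t u : R, 0 < t < tau ->
        (fun s => X s u)^`() t = curvature_vector (X t) u].

(* The solution cannot be continued past [tau], which is then the extinction
   time. *)
Definition csf_evolution (c : R -> R * R) (tau : R) (X : R -> R -> R * R) :
    Prop :=
  csf_solution c tau X /\
  forall tau' X', csf_solution c tau' X' -> tau' <= tau.

(* The evolution is empty, hence of length 0, from the extinction time on. *)
Definition evolution_length (tau : R) (X : R -> R -> R * R) (t : R) : \bar R :=
  if t < tau then curve_length (X t) else 0%E.

Definition sine_graph (beta : R) : set (R * R) :=
  [set (x, sin x^-1) | x in `]0, beta[].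

Definition vseg : set (R * R) := [set p | p.1 = 0 /\ -1 <= p.2 <= 1].

Definition closing_arc (beta : R) (s : R -> R * R) : Prop :=
  [/\ smooth_curve s,
      forall u : R, 0 <= u <= 1 -> s^`() u != 0,
      {in `[0, 1] &, injective s},
      s 0 = (beta, sin beta^-1) /\ vseg (s 1)
    & forall u : R, 0 < u < 1 -> ~ (sine_graph beta `|` vseg) (s u)].

Definition topologist_sine_curve T : Prop :=
  exists beta s, [/\ 0 < beta, closing_arc beta s
    & T = sine_graph beta `|` vseg `|` s @` `[0, 1]].

(* Away from [B_e(V)], the set [T] is covered by a regular simple arc [a] in
   [T], and after reparametrization the curves [c n] consist there of a single
   arc converging to [a] with all derivatives. The arc is allowed to enter
   [B_e(V)] since [T \ B_e(V)] itself need not be connected. *)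
Definition smooth_cvg_outside (e : R) (c : nat -> R -> R * R) T : Prop :=
  exists (l r : R) (a : R -> R * R) (phi : nat -> R -> R),
    [/\ l < r,
        [/\ smooth_curve a, forall u : R, l <= u <= r -> a^`() u != 0
          & {in `[l, r] &, injective a}],
        T `\` eucl_nbhd e vseg `<=` a @` `[l, r] /\ a @` `[l, r] `<=` T `\` vseg,
        forall n, smooth_fun (phi n)
      & (\forall n \near \oo,
           range (c n) `\` eucl_nbhd e vseg `<=` (c n \o phi n) @` `[l, r]) /\
        forall k : nat,
          {uniform `[l, r], (fun n => (c n \o phi n)^`(k)) @ \oo --> a^`(k)}].

Definition omega_graph (w : nat) (c : R -> R * R) : Prop :=
  forall x : R, ([set p | range c p /\ p.1 = x] #<= `I_w)%card.

Definition allowable (c : nat -> R -> R * R) T : Prop :=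
  [/\ forall n, smooth_closed_curve (c n),
      hausdorff_dist (range (c n)) T @[n --> \oo] --> 0%E,
      forall e : R, 0 < e -> smooth_cvg_outside e c T
    & exists2 w : nat, (0 < w)%N & forall n, omega_graph w (c n)].

Definition allowable_inside (c : nat -> R -> R * R) T : Prop :=
  [/\ allowable c T,
      forall n, range (c n) `<=` bounded_region T
    & forall n, bounded_region (range (c n)) `<=`
                bounded_region (range (c n.+1))].

Definition allowable_outside (c : nat -> R -> R * R) T : Prop :=
  [/\ allowable c T,
      forall n, range (c n) `<=` ~` closure (bounded_region T),
      forall n, closure (bounded_region T) `<=` bounded_region (range (c n))
    & forall n, bounded_region (range (c n.+1)) `<=`
                bounded_region (range (c n))].

End Plane.

(* Main.v *)
Require Import Defs.
From mathcomp Require Import all_boot all_order all_algebra.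
From mathcomp Require Import all_classical all_reals all_analysis.
From mathcomp Require Import measurable_realfun ring lra.

Set Implicit Arguments.
Unset Strict Implicit.
Unset Printing Implicit Defensive.

Import Order.TTheory GRing.Theory Num.Theory.
Import numFieldNormedType.Exports.

Local Open Scope ring_scope.
Local Open Scope classical_set_scope.

(* Only two features of the approximations matter: they stay in a bounded set,
   and vertical lines meet them at most [w] times.

   The flow does not increase the anisotropic lengths [int sqrt(x_u^2 + m y_u^2)]
   with [m > 0]. Letting [m] tend to 0, the horizontal variation [int |x_u|] stays
   below its initial value, which is at most [C = 2 B w] when [|x| <= B] initially;
   and [|y| <= D] is preserved by the maximum principle. With [T] the unit tangent
   and [L] the length,
     L = int x_u T1 + int y_u T2 <= C - int y (T2)_u <= C + D int |k T1| ds
       <= C + D (C int k^2 ds)^(1/2)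
   where [k] is the curvature. Since [L' = - int k^2 ds], this is the Riccati
   inequality [L' <= - (L - C)^2 / (D^2 C)], hence [L(t) <= C + D^2 C / t]
   whatever the initial length. *)

(** * Integrals and derivatives on an interval *)

(** Along the curve [T2] has arclength derivative [k T1], and keeping the factor [T1] is decisive.
    The Cauchy-Schwarz inequality with weight [|T1|] costs the horizontal variation, which is at
    most [C]. Without the weight it would cost [L] and give only a linear differential inequality
    for large [L], whose solutions remember the initial length. Nothing bounds that length along the
    approximations: the multiplicity on vertical lines controls the horizontal variation alone. The
    integrand [|x_u|] is not differentiable at vertical tangents, hence the detour through [m > 0],
    where the norm is smooth away from 0 and the energy has an explicit derivative of constant sign.
    The flow equation is available at positive times only. Monotonicity therefore starts at a small
    [s > 0], and the initial value is reached by continuity, uniformly in the parameter. The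
    Cauchy-Schwarz step is carried out as a pointwise Young inequality with a constant weight,
    integrated afterwards. *)

Section Integral01.
Context {R : realType}.
Local Notation mu := (@lebesgue_measure R).
Implicit Types f g F G : R -> R.

Lemma continuous_integrable01 f :
  continuous f -> mu.-integrable `[0, 1] (EFin \o f).
Proof.
move=> cf; apply: continuous_compact_integrable; first exact: segment_compact.
exact: continuous_subspaceT.
Qed.

Lemma is_derive_continuous f g : (forall u : R, is_derive u 1 f (g u)) -> continuous f.
Proof.
move=> fg u; apply: differentiable_continuous; apply/derivable1_diffP.
by have [] := fg u.
Qed.

Lemma integration_by_parts_periodic F G f g :
  (forall u : R, is_derive u 1 F (f u)) -> (forall u : R, is_derive u 1 G (g u)) ->
  continuous f -> continuous g -> F 1 = F 0 -> G 1 = G 0 ->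
  \int[mu]_(u in `[0, 1]) (F u * g u) = - \int[mu]_(u in `[0, 1]) (f u * G u).
Proof.
move=> Ff Gg cf cg F1 G1.
have oo (H h : R -> R) : (forall u : R, is_derive u 1 H (h u)) ->
    derivable_oo_LRcontinuous H 0 1.
  move=> Hh; have cH := is_derive_continuous Hh; split.
  - by move=> u _; have [] := Hh u.
  - by apply: cvg_at_right_filter; exact: cH.
  - by apply: cvg_at_left_filter; exact: cH.
rewrite (@Rintegration_by_parts _ F G f g)//; first by rewrite F1 G1 subrr sub0r.
- exact: continuous_subspaceT.
- exact: oo Ff.
- by move=> u _; rewrite derive1E; have [_ ->] := Ff u.
- exact: continuous_subspaceT.
- exact: oo Gg.
- by move=> u _; rewrite derive1E; have [_ ->] := Gg u.
Qed.

Lemma le_integral01 f g : continuous f -> continuous g ->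
  (forall u : R, 0 <= u <= 1 -> f u <= g u) ->
  \int[mu]_(u in `[0, 1]) f u <= \int[mu]_(u in `[0, 1]) g u.
Proof.
by move=> cf cg fg; apply: le_Rintegral => //; exact: continuous_integrable01.
Qed.

Lemma integral01_cst c : \int[mu]_(u in `[0, 1]) c = c.
Proof.
rewrite Rintegral_cst; last exact: measurable_itv.
by rewrite /= lebesgue_measure_itv/= lte_fin ltr01 oppr0 adde0 mulr1.
Qed.

Lemma integral01D f g : continuous f -> continuous g ->
  \int[mu]_(u in `[0, 1]) (f u + g u) =
  \int[mu]_(u in `[0, 1]) f u + \int[mu]_(u in `[0, 1]) g u.
Proof. by move=> cf cg; rewrite RintegralD//; exact: continuous_integrable01. Qed.

Lemma integral01Z c f : continuous f ->
  \int[mu]_(u in `[0, 1]) (c * f u) = c * \int[mu]_(u in `[0, 1]) f u.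
Proof. by move=> cf; rewrite RintegralZl//; exact: continuous_integrable01. Qed.

End Integral01.

(** * Uniformity over the compact parameter interval *)

Section TwoVariables.
Context {R : realType}.
Implicit Types (f : R * R -> R) (a b t u : R).

(** Tube lemma: each [u] has a product neighbourhood on which [f] stays within [e / 2] of
    [f (t, u)], and compactness of [[0, 1]] leaves a single neighbourhood of [t]. *)
Lemma near_uniform01 f t : (forall u : R, 0 <= u <= 1 -> {for (t, u), continuous f}) ->
  forall e, 0 < e ->
  \forall s \near t, forall u : R, 0 <= u <= 1 -> `|f (s, u) - f (t, u)| < e.
Proof.
move=> cf e e0.
have /compact_near_coveringP := @segment_compact R 0 1.
move=> /(_ R (nbhs t) (fun s u => `|f (s, u) - f (t, u)| < e)) H.
near=> s => u u01.
have : `[0, 1] `<=` [set u | `|f (s, u) - f (t, u)| < e].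
  near: s; apply: H => v /= v01.
  rewrite in_itv/= in v01.
  have e2 : 0 < e / 2 by rewrite divr_gt0.
  have /cvgrPdist_lt/(_ _ e2) := cf _ v01.
  case=> -[A B] /= [nA nB] AB.
  exists (B, A) => //= -[v' s] [/= Bv As].
  have h1 := AB (s, v') (conj As Bv).
  have h2 := AB (t, v') (conj (nbhs_singleton nA) Bv).
  rewrite /= in h1 h2.
  rewrite [e]splitr (le_lt_trans (ler_distD (f (t, v)) _ _))//.
  by rewrite ltrD// distrC.
by apply; rewrite /= in_itv.
Unshelve. all: by end_near. Qed.

(** Supplies the constant that dominates the time derivative of the anisotropic norm when
    differentiating under the integral sign. *)
Lemma bounded_on_box f a b :
  (forall t u : R, a <= t <= b -> 0 <= u <= 1 -> {for (t, u), continuous f}) ->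
  exists M, forall t u : R, a <= t <= b -> 0 <= u <= 1 -> `|f (t, u)| <= M.
Proof.
move=> cf.
have cK : compact (`[a, b] `*` `[0, 1] : set (R * R)).
  by apply: compact_setX; exact: segment_compact.
have : compact (f @` (`[a, b] `*` `[0, 1])).
  apply: continuous_compact => //.
  apply: continuous_in_subspaceT => -[t u]; rewrite inE/= !in_itv/= => -[ht hu].
  exact: cf.
move=> /compact_bounded[M [_ /(_ (M + 1))]]; rewrite ltrDl ltr01 => /(_ isT) H.
by exists (M + 1) => t u ht hu; apply: H => /=; exists (t, u).
Qed.

End TwoVariables.

(** * One-variable calculus, the Riccati inequality and the parabolic maximum principle *)

Section Calculus.
Context {R : realType}.

(** In Caratheodory's form [k s - k t = q s * (s - t)] with [q] continuous at [t] and [q t = l], so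
    the product is [q s * (s - t) ^+ 2]. *)
Lemma is_derive_near_gt0 (k : R -> R) (t l : R) : is_derive t 1 k l -> 0 < l ->
  \forall s \near t, s != t -> 0 < (k s - k t) * (s - t).
Proof.
move=> /is_derive1_caratheodory[q [kE cq qt]] l0.
have : \forall s \near t, 0 < q s by apply: (cvgr_gt _ cq); rewrite qt.
apply: filterS => s qs st.
by rewrite kE -mulrA mulr_gt0// -expr2 exprn_even_gt0//= subr_eq0.
Qed.

(** Meant for a space-time maximum that may sit at the final time, where only earlier times can be
    compared. *)
Lemma is_derive_at_max_left (k : R -> R) (t l a : R) : a < t ->
  is_derive t 1 k l -> (forall s : R, a <= s <= t -> k s <= k t) -> 0 <= l.
Proof.
move=> ta kl kmax; rewrite leNgt; apply/negP => l0.
have Nkl : is_derive t 1 (fun s => - k s) (- l) by exact: is_deriveN.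
have := is_derive_near_gt0 Nkl; rewrite oppr_gt0 => /(_ l0) near_t.
near t^'- => s.
have st : s < t by near: s; exact: nbhs_left_lt.
have : 0 < (- k s - - k t) * (s - t).
  have : s != t -> 0 < (- k s - - k t) * (s - t).
    by near: s; exact: cvg_within near_t.
  by apply; rewrite lt_eqF.
apply/negP; rewrite -leNgt nmulr_lle0 ?subr_lt0//.
rewrite opprK addrC subr_ge0; apply: kmax.
by rewrite (ltW st) andbT; near: s; exact: nbhs_left_ge.
Unshelve. all: by end_near. Qed.

(** If [l] were positive, [k'], which vanishes at [u], would be positive just to the right of [u],
    and the mean value theorem would lift [k] above its maximum. *)
Lemma second_derivative_at_max (k k' : R -> R) (u l a b : R) : a < u < b ->
  (forall v : R, a < v < b -> is_derive v 1 k (k' v)) ->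
  is_derive u 1 k' l -> (forall v : R, a < v < b -> k v <= k u) ->
  k' u = 0 /\ l <= 0.
Proof.
move=> /andP[au ub] kk' k'l kmax.
have k'u : k' u = 0.
  have k0 : is_derive u 1 k 0.
    apply: (@derive1_at_max _ k a b) => //.
    - by rewrite (ltW (lt_trans au ub)).
    - by move=> v; rewrite in_itv/= => /kk'[].
    - by rewrite in_itv/= au.
  have [_ k1] : is_derive u 1 k (k' u) by apply: kk'; rewrite au.
  by rewrite -k1; have [_ ->] := k0.
split=> //; rewrite leNgt; apply/negP => l0.
have /nbhs_ballP[d /= d0 Hd] := is_derive_near_gt0 k'l l0.
pose w := Num.min (u + d / 2) ((u + b) / 2).
have uw : u < w.
  by rewrite lt_min ltrDl divr_gt0//= midf_lt.
have wb : w < b by rewrite gt_min midf_lt ?orbT.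
have wd : w < u + d.
  by rewrite gt_min ltrD2l ltr_pdivrMr// ltr_pMr// ltr1n.
have [c + E] : exists2 c, c \in `]u, w[%R & k w - k u = k' c * (w - u).
  apply: MVT => // [v|].
    rewrite in_itv/= => /andP[uv vw]; apply: kk'.
    by rewrite (lt_trans au uv) (lt_trans vw wb).
  apply: derivable_within_continuous => v; rewrite in_itv/= => /andP[uv vw].
  have [] // : is_derive v 1 k (k' v).
  by apply: kk'; rewrite (lt_le_trans au uv) (le_lt_trans vw wb).
rewrite in_itv/= => /andP[uc cw].
have : 0 < (k' c - k' u) * (c - u).
  apply: Hd; last by rewrite gt_eqF.
  by rewrite /= /ball/= ltr0_norm ?subr_lt0// opprB ltrBlDl (lt_trans cw).
rewrite k'u subr0 pmulr_lgt0 ?subr_gt0// => k'c.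
have : k w <= k u by apply: kmax; rewrite wb (lt_trans au uw).
by apply/negP; rewrite -ltNge -subr_gt0 E mulr_gt0// subr_gt0.
Qed.

(** Schwarz's theorem. The second difference of [h] over a square of side [a] is expanded by the
    mean value theorem in both orders, so [htu] and [hut] agree at two points of the square;
    continuity at the corner concludes as the square shrinks. *)
Lemma mixed_derivatives_eq (h ht hu htu hut : R -> R -> R) (t0 u0 d : R) :
  0 < d ->
  (forall t u : R, `|t - t0| < d -> `|u - u0| < d ->
    [/\ is_derive t 1 (h ^~ u) (ht t u), is_derive u 1 (h t) (hu t u),
        is_derive u 1 (ht t) (htu t u) & is_derive t 1 (hu ^~ u) (hut t u)]) ->
  {for (t0, u0), continuous (fun p => htu p.1 p.2)} ->
  {for (t0, u0), continuous (fun p => hut p.1 p.2)} ->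
  htu t0 u0 = hut t0 u0.
Proof.
move=> d0 Hd ctu cut.
apply/eqP; rewrite -subr_eq0 -normr_eq0 eq_le normr_ge0 andbT.
apply/ler_addgt0Pl => e e0; rewrite addr0.
have e2 : 0 < e / 2 by rewrite divr_gt0.
have /cvgrPdist_lt/(_ _ e2)/nbhs_ballP[r1 /= r10 H1] := ctu.
have /cvgrPdist_lt/(_ _ e2)/nbhs_ballP[r2 /= r20 H2] := cut.
have [a [a0 ad ar1 ar2]] : exists a, [/\ 0 < a, a < d, a < r1 & a < r2].
  exists (Num.min d (Num.min r1 r2) / 2).
  have m0 : 0 < Num.min d (Num.min r1 r2) by rewrite !lt_min d0 r10.
  have : Num.min d (Num.min r1 r2) / 2 < Num.min d (Num.min r1 r2).
    by rewrite ltr_pdivrMr// ltr_pMr// ltr1n.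
  by rewrite !lt_min => /and3P[-> -> ->]; rewrite divr_gt0.
have inside s0 s : s0 <= s <= s0 + a -> `|s - s0| <= a.
  by move=> /andP[h1 h2]; rewrite ger0_norm ?subr_ge0// lerBlDl.
have insided s0 s : s0 <= s <= s0 + a -> `|s - s0| < d.
  by move=> /inside /le_lt_trans; exact.
have itvI s0 s : s \in `]s0, s0 + a[%R -> s0 <= s <= s0 + a.
  by rewrite in_itv/= => /andP[/ltW -> /ltW ->].
have lta s0 : s0 < s0 + a by rewrite ltrDl.
have bnd s0 : s0 <= s0 <= s0 + a /\ s0 <= s0 + a <= s0 + a.
  by rewrite !lexx (ltW (lta _)).
have [D1 D2] := bnd t0; have [E1 E2] := bnd u0.
have mvt (k k' : R -> R) s0 :
    (forall s : R, s0 <= s <= s0 + a -> is_derive s 1 k (k' s)) ->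
    exists2 c, s0 <= c <= s0 + a & k (s0 + a) - k s0 = k' c * a.
  move=> kk'.
  have [c /itvI ci ->] : exists2 c, c \in `]s0, s0 + a[%R &
      k (s0 + a) - k s0 = k' c * (s0 + a - s0).
    apply: MVT => // [s /itvI|]; first exact: kk'.
    by apply: derivable_within_continuous => s; rewrite in_itv/= => /kk'[].
  by exists c => //; rewrite addrAC subrr add0r.
have [x1 x1i X1] := mvt (fun t => h t (u0 + a) - h t u0)
  (fun t => ht t (u0 + a) - ht t u0) t0 (fun t ti => is_deriveB
    (let: And4 p _ _ _ := Hd _ _ (insided _ _ ti) (insided _ _ E2) in p)
    (let: And4 p _ _ _ := Hd _ _ (insided _ _ ti) (insided _ _ E1) in p)).
have [y1 y1i Y1] := mvt (ht x1) (htu x1) u0 (fun u ui =>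
  let: And4 _ _ p _ := Hd _ _ (insided _ _ x1i) (insided _ _ ui) in p).
have [y2 y2i Y2] := mvt (fun u => h (t0 + a) u - h t0 u)
  (fun u => hu (t0 + a) u - hu t0 u) u0 (fun u ui => is_deriveB
    (let: And4 _ p _ _ := Hd _ _ (insided _ _ D2) (insided _ _ ui) in p)
    (let: And4 _ p _ _ := Hd _ _ (insided _ _ D1) (insided _ _ ui) in p)).
have [x2 x2i X2] := mvt (hu ^~ y2) (hut ^~ y2) t0 (fun t ti =>
  let: And4 _ _ _ p := Hd _ _ (insided _ _ ti) (insided _ _ y2i) in p).
have eqm : htu x1 y1 = hut x2 y2.
  apply: (mulIf (lt0r_neq0 a0)); apply: (mulIf (lt0r_neq0 a0)).
  by rewrite -Y1 -X2 -X1 -Y2; ring.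
have h1 := H1 (x1, y1); have h2 := H2 (x2, y2).
have -> : htu t0 u0 - hut t0 u0 =
    (htu t0 u0 - htu x1 y1) - (hut t0 u0 - hut x2 y2) by rewrite eqm; ring.
rewrite [e]splitr (le_trans (ler_normB _ _))// ltW// ltrD//.
- apply: h1; split; rewrite /ball/= distrC;
  by apply: le_lt_trans ar1; apply: inside.
- apply: h2; split; rewrite /ball/= distrC;
  by apply: le_lt_trans ar2; apply: inside.
Qed.

(** As long as [L > C], the function [1 / (L - C)] has derivative [Q / (L - C) ^+ 2 >= 1 / K], so it
    is at least [T / K] at time [T] whatever its earlier values. If the bound failed then [L T > C],
    and since [L] decreases, [L > C] would hold on all of []0, T]]. *)
Lemma riccati_bound (L Q : R -> R) (T C K : R) : 0 < T -> 0 < K ->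
  (forall s, 0 < s <= T -> is_derive s 1 L (- Q s)) ->
  (forall s, 0 < s <= T -> 0 <= Q s) ->
  (forall s, 0 < s <= T -> C < L s -> (L s - C) ^+ 2 <= K * Q s) ->
  L T <= C + K / T.
Proof.
move=> T0 K0 dL Q0 LQ; rewrite leNgt; apply/negP => LT.
have CLT : C < L T by apply: lt_trans LT; rewrite ltrDl divr_gt0.
have Ldec s : 0 < s <= T -> L T <= L s.
  move=> /andP[s0 sT].
  have pos v : s <= v <= T -> 0 < v <= T.
    by move=> /andP[sv ->]; rewrite (lt_le_trans s0 sv).
  apply: (@ler0_derive1_nincr _ L s T) => //.
  - by move=> v; rewrite in_itv/= => /andP[/ltW h1 /ltW h2];
      have [|//] := dL v; apply: pos; rewrite h1.
  - move=> v; rewrite in_itv/= => /andP[/ltW h1 /ltW h2].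
    have vT : 0 < v <= T by apply: pos; rewrite h1.
    by rewrite derive1E; have [_ ->] := dL v vT; rewrite oppr_le0 Q0.
  - apply: derivable_within_continuous => v; rewrite in_itv/= => /pos vT.
    by have [] := dL v vT.
have LC s : 0 < s <= T -> 0 < L s - C.
  by move=> /Ldec h; rewrite subr_gt0 (lt_le_trans CLT).
pose g s := (L s - C)^-1.
have dg s : 0 < s <= T -> is_derive s 1 g (Q s / (L s - C) ^+ 2).
  move=> sT; have LCs := LC s sT.
  have dLC : is_derive s 1 (fun v => L v - C) (- Q s).
    by have := is_deriveB (dL s sT) (is_derive_cst C s 1); rewrite subr0.
  apply: is_derive_eq (is_deriveV _ dLC) _; first by rewrite gt_eqF.
  by rewrite /GRing.scale/= mulrNN mulrC.
have TT : 0 < T <= T by rewrite T0 lexx.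
have gT s : 0 < s < T -> T - s <= K * g T.
  move=> /andP[s0 sT].
  have pos v : s <= v <= T -> 0 < v <= T.
    by move=> /andP[sv ->]; rewrite (lt_le_trans s0 sv).
  have [c ci gE] : exists2 c, c \in `]s, T[%R &
      g T - g s = Q c / (L c - C) ^+ 2 * (T - s).
    apply: (@MVT _ g (fun c => Q c / (L c - C) ^+ 2)) => // [v|].
      by rewrite in_itv/= => /andP[/ltW h1 /ltW h2]; apply/dg/pos; rewrite h1.
    apply: derivable_within_continuous => v; rewrite in_itv/= => /pos vT.
    by have [] := dg v vT.
  move: ci; rewrite in_itv/= => /andP[/ltW h1 /ltW h2].
  have cT : 0 < c <= T by apply: pos; rewrite h1.
  have LCc := LC c cT.
  have KQ : 1 <= K * (Q c / (L c - C) ^+ 2).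
    rewrite mulrA ler_pdivlMr ?exprn_gt0// mul1r; apply: LQ => //.
    by rewrite -subr_gt0.
  have gs0 : 0 <= g s by rewrite invr_ge0 ltW// LC// s0 ltW.
  have : T - s <= K * (g T - g s).
    by rewrite gE mulrA ler_peMl// subr_ge0 ltW.
  by move=> /le_trans; apply; rewrite ler_pM2l// gerBl.
(* Let [s] tend to 0 in [gT]; the hypotheses say nothing at time 0 itself. *)
have : T <= K * g T.
  apply/ler_addgt0Pr => e e0.
  have [eT|Te] := ltP e T; first by rewrite -lerBlDr gT// e0.
  by rewrite (le_trans Te)// lerDr mulr_ge0 ?(ltW K0)// invr_ge0 ltW// LC.
rewrite /g ler_pdivlMr ?LC// mulrC -ler_pdivlMr// lerBlDl.
by apply/negP; rewrite -ltNge.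
Qed.

(** A maximum of [h - e t] at a positive time would give [ht >= e > 0] there, while the spatial
    conditions at the same point give [ht <= 0]. So it lies at time 0, and [e] is then sent to 0. *)
Lemma maximum_principle (h hu huu ht : R -> R -> R) (T M : R) :
  (forall t u : R, 0 <= t <= T -> {for (t, u), continuous (fun p => h p.1 p.2)}) ->
  (forall t u : R, 0 <= t <= T -> h t (u + 1) = h t u) ->
  (forall t u : R, 0 < t <= T -> [/\ is_derive t 1 (h ^~ u) (ht t u),
    is_derive u 1 (h t) (hu t u) & is_derive u 1 (hu t) (huu t u)]) ->
  (forall t u : R, 0 < t <= T -> hu t u = 0 -> huu t u <= 0 -> ht t u <= 0) ->
  (forall u : R, h 0 u <= M) ->
  forall t u : R, 0 <= t <= T -> 0 <= u <= 1 -> h t u <= M.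
Proof.
move=> ch hper dh hle h0 t u tT u01.
have T0 : 0 <= T by case/andP: tT => /le_trans; apply.
suff H e : 0 < e -> h t u <= M + e * t.
  apply/ler_addgt0Pl => e e0; rewrite addrC.
  have [t0|t0] := leP t 0.
    by rewrite (le_trans (H _ e0))// lerD2l (le_trans _ (ltW e0))// mulr_ge0_le0// ltW.
  by have := H _ (divr_gt0 e0 t0); rewrite divfK// gt_eqF.
move=> e0.
(* Two periods, so that a maximum at the edge [u = 0] or [u = 2] can be moved by periodicity to the
   interior point [u = 1]. *)
pose K : set (R * R) := `[0, T] `*` `[0, 2].
have cK : compact K by apply: compact_setX; exact: segment_compact.
have [[t0 u0]] : exists2 p, p \in K & forall q, q \in K ->
    h q.1 q.2 - e * q.1 <= h p.1 p.2 - e * p.1.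
  apply: compact_EVT_max => //.
    by exists (0, 0); split => /=; rewrite in_itv/= lexx ?T0// ler0n.
  apply: continuous_in_subspaceT => -[s v]; rewrite inE => -[/= sT _].
  apply: cvgB; first by apply: ch; move: sT; rewrite in_itv.
  by apply: cvgM; [exact: cvg_cst|exact: cvg_fst].
rewrite inE => -[]/=; rewrite !in_itv/= => t0T u02 Hmax.
have {}Hmax s v : 0 <= s <= T -> 0 <= v <= 2 -> h s v - e * s <= h t0 u0 - e * t0.
  by move=> sT v2; apply: (Hmax (s, v)); rewrite inE; split; rewrite /= in_itv.
have [u1 u1i hu1] : exists2 u1, 0 < u1 < 2 & forall s : R, 0 <= s <= T -> h s u0 = h s u1.
  have [->|u00] := eqVneq u0 0.
    exists 1; first by rewrite ltr01 ltr1n.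
    by move=> s sT; rewrite -[1]add0r hper.
  have [->|u02'] := eqVneq u0 2.
    exists 1; first by rewrite ltr01 ltr1n.
    by move=> s sT; rewrite -(hper s 1 sT).
  by exists u0 => //; rewrite !lt_neqAle u02' eq_sym u00.
have t0' : 0 < t0 -> False.
  move=> t00; have t0T' : 0 < t0 <= T by rewrite t00; case/andP: t0T.
  have [dt du duu] := dh t0 u1 t0T'.
  have [hu0 huu0] : hu t0 u1 = 0 /\ huu t0 u1 <= 0.
    apply: (@second_derivative_at_max (h t0) (hu t0) u1 _ 0 2) => //.
      by move=> v _; have [] := dh t0 v t0T'.
    move=> v /andP[v0 v2]; have := Hmax t0 v t0T; rewrite (ltW v0) (ltW v2).
    by move=> /(_ isT); rewrite lerD2r -hu1.
  have : 0 <= ht t0 u1 - e * 1.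
    apply: (@is_derive_at_max_left (fun s => h s u1 - e * s) t0 _ 0) => //.
    move=> s /andP[s0 st]; have sT : 0 <= s <= T.
      by rewrite s0 (le_trans st)//; case/andP: t0T.
    by rewrite -!hu1//; apply: Hmax.
  by apply/negP; rewrite -ltNge mulr1 subr_lt0 (le_lt_trans (hle _ _ t0T' hu0 huu0)).
have t00 : t0 = 0.
  apply/eqP; rewrite eq_le; case/andP: t0T => -> _; rewrite andbT leNgt.
  by apply/negP.
have := Hmax t u tT; rewrite t00 mulr0 subr0 lerBlDr => Hm.
apply: (le_trans (Hm _)); last by rewrite lerD2r.
by case/andP: u01 => -> /= /le_trans; apply; rewrite ler1n.
Qed.

End Calculus.

(** * Total variation and multiplicity of level sets *)

Section Variation.
Context {R : realType}.
Local Notation mu := (@lebesgue_measure R).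
Implicit Types f g : R -> R.

Lemma continuous_primitive01 g : continuous g -> exists G : R -> R,
  (forall u : R, 0 <= u <= 1 -> is_derive u 1 G (g u)) /\
  \int[mu]_(u in `[0, 1]) g u = G 1 - G 0.
Proof.
(* Integrating from -1 makes 0 an interior point, so that the primitive has a two-sided derivative
   there as well. *)
move=> cg; pose G x : R := (\int[mu]_(u in `[-1, x]) g u)%R.
have iT (a b : R) : mu.-integrable `[a, b] (EFin \o g).
  apply: continuous_compact_integrable; first exact: segment_compact.
  exact: continuous_subspaceT.
have GE (u : R) : 0 <= u <= 1 -> is_derive u 1 G (g u).
  move=> /andP[u0 u1].
  have [dG GE] := @continuous_FTC1_closed R g (-1) u 2
    (le_lt_trans u1 (ltr1n _ 2)) (iT _ _) (lt_le_trans (ltrN10 _) u0) (cg u).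
  by apply: DeriveDef; [exact: dG|rewrite -derive1E; exact: GE].
exists G; split => //.
rewrite /Rintegral (@continuous_FTC2 _ g G)//.
- exact: continuous_subspaceT.
- split.
  + move=> u; rewrite in_itv/= => /andP[/ltW u0 /ltW u1].
    by have [|//] := GE u; rewrite u0.
  + apply: cvg_at_right_filter; apply: differentiable_continuous.
    by apply/derivable1_diffP; have [|//] := GE 0; rewrite lexx ler01.
  + apply: cvg_at_left_filter; apply: differentiable_continuous.
    by apply/derivable1_diffP; have [|//] := GE 1; rewrite lexx ler01.
- move=> u; rewrite in_itv/= => /andP[/ltW u0 /ltW u1].
  by rewrite derive1E; have [|//] := GE u; rewrite u0.
Qed.

(** On each of [n] equal intervals the mean value theorem is applied to [f] and to a primitive of
    [|f'|]. The two intermediate points are closer than [1 / n], so by uniform continuity the values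
    of [f'] there differ by less than [e]. *)
Lemma integral_norm_derive_le_variation f f' (e : R) :
  (forall u : R, is_derive u 1 f (f' u)) -> continuous f' -> 0 < e ->
  exists2 n : nat, (0 < n)%N & \int[mu]_(u in `[0, 1]) `|f' u| <=
    \sum_(i < n) `|f (i.+1%:R / n%:R) - f (i%:R / n%:R)| + e.
Proof.
move=> ff' cf' e0.
have cg : continuous (fun u => `|f' u|).
  by move=> u; apply: cvg_norm; exact: cf'.
have [G [GE ->]] := continuous_primitive01 cg.
(* Uniform continuity of [f'] on [[0, 1]]: the first variable is a small shift, compared with the
   shift 0. *)
have /near_uniform01/(_ _ e0)/nbhs_ballP[d /= d0 Hd] : forall u : R, 0 <= u <= 1 ->
    {for (0, u), continuous (fun p : R * R => f' (p.1 + p.2))}.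
  move=> u _; apply: (@continuous_comp _ _ _ (fun p : R * R => p.1 + p.2) f').
    by apply: cvgD; [exact: cvg_fst|exact: cvg_snd].
  exact: cf'.
pose n := (Num.truncn d^-1).+1.
have n0 : 0 < n%:R :> R by rewrite ltr0n.
have nd : n%:R^-1 < d.
  by rewrite invf_plt ?posrE// truncnS_gt.
exists n => //.
pose t i : R := i%:R / n%:R.
have -> : G 1 - G 0 = \sum_(i < n) (G (t i.+1) - G (t i)).
  rewrite -(big_mkord xpredT (fun i => G (t i.+1) - G (t i))).
  by rewrite telescope_sumr// /t divff ?mul0r// gt_eqF.
have -> : e = \sum_(i < n) (e / n%:R).
  by rewrite sumr_const card_ord -[RHS]mulr_natr divfK// gt_eqF.
rewrite -big_split/=; apply: ler_sum => i _.
have tS : t i.+1 - t i = n%:R^-1.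
  by rewrite /t -mulrBl -[i.+1]addn1 natrD addrAC subrr add0r mul1r.
have tlt : t i < t i.+1 by rewrite -subr_gt0 tS invr_gt0.
have t0 : 0 <= t i by rewrite divr_ge0// ltW.
have t1 : t i.+1 <= 1 by rewrite ler_pdivrMr// mul1r ler_nat.
have [x xi fx] : exists2 c, c \in `]t i, t i.+1[%R &
    f (t i.+1) - f (t i) = f' c * (t i.+1 - t i).
  apply: MVT => //; apply: continuous_subspaceT.
  exact: is_derive_continuous ff'.
have [y yi Gy] : exists2 c, c \in `]t i, t i.+1[%R &
    G (t i.+1) - G (t i) = `|f' c| * (t i.+1 - t i).
  have ti (u : R) : t i <= u <= t i.+1 -> 0 <= u <= 1.
    by move=> /andP[h1 h2]; rewrite (le_trans t0 h1) (le_trans h2 t1).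
  apply: (@MVT _ _ (fun u => `|f' u|)) => // [u|].
    by rewrite in_itv/= => /andP[/ltW h1 /ltW h2]; apply/GE/ti; rewrite h1.
  apply: derivable_within_continuous => u; rewrite in_itv/= => ui.
  by have [] := GE _ (ti _ ui).
rewrite Gy -/(t _) -/(t _) fx tS normrM [`|n%:R^-1|]gtr0_norm ?invr_gt0//.
rewrite -mulrDl ler_pM2r ?invr_gt0// -lerBlDl (le_trans (lerB_dist _ _))//.
move: xi yi; rewrite !in_itv/= => /andP[x1 x2] /andP[y1 y2].
have yx : ball 0 d (y - x).
  rewrite /ball/= sub0r normrN ltr_norml; lra.
have x01 : 0 <= x <= 1 by rewrite (le_trans t0 (ltW x1)) (le_trans (ltW x2) t1).
by have := Hd _ yx x x01; rewrite /= subrK add0r => /ltW.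
Qed.

(* By the intermediate value theorem, a value lying strictly between the
   endpoint values of [k] of the [n] intervals is attained at least [k] times;
   integrating over all values bounds the sum of the oscillations. *)
Lemma variation_le_multiplicity f (w n : nat) (B : R) :
  continuous f -> (forall u, `|f u| <= B) ->
  (forall v : R, [set u | 0 <= u < 1 /\ f u = v] #<= `I_w)%card ->
  \sum_(i < n) `|f (i.+1%:R / n%:R) - f (i%:R / n%:R)| <= w%:R * (B + B).
Proof.
move=> cf fB mult.
have B0 : 0 <= B by rewrite (le_trans _ (fB 0)).
pose t i : R := i%:R / n%:R.
pose a (i : 'I_n) := Num.min (f (t i)) (f (t i.+1)).
pose b (i : 'I_n) := Num.max (f (t i)) (f (t i.+1)).
pose J i : set R := `]a i, b i[.
have ab i : a i <= b i by rewrite /a /b le_max !ge_min !lexx.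
have baE i : b i - a i = `|f (t i.+1) - f (t i)|.
  rewrite /a /b; have [h|h] := leP (f (t i)) (f (t i.+1)).
    by rewrite ger0_norm ?subr_ge0.
  by rewrite ltr0_norm ?subr_lt0// opprB.
have muJ i : mu (J i) = (b i - a i)%:E.
  rewrite /J/= lebesgue_measure_itv/= lte_fin; case: ltP => //= h.
  by rewrite (_ : b i = a i) ?subrr//; apply/eqP; rewrite eq_le h ab.
pose K : set R := `[- B, B].
have muB : mu K = (B + B)%:E.
  rewrite /K/= lebesgue_measure_itv/= lte_fin; case: ltP => //= h.
    by rewrite -EFinD opprK.
  by rewrite (_ : B = 0) ?addr0//; lra.
have count v : \sum_(i < n) \1_(J i) v <= w%:R :> R.
  pose A := [set i | v \in J i]%SET.
  have -> : \sum_(i < n) \1_(J i) v = #|A|%:R :> R.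
    rewrite -sumr_const [RHS]big_mkcond/=; apply: eq_bigr => i _.
    by rewrite indicE inE; case: ifPn.
  have H (i : 'I_n) : exists u, v \in J i -> t i < u < t i.+1 /\ f u = v.
    have [vi|vi] := boolP (v \in J i); last by exists 0.
    have n0 : 0 < n%:R :> R.
      by rewrite ltr0n (leq_ltn_trans (leq0n _) (ltn_ord i)).
    have titS : t i < t i.+1 by rewrite /t ltr_pM2r ?invr_gt0// ltr_nat.
    move: vi; rewrite inE /J/= in_itv/= => /andP[av vb].
    have [u] : exists2 u, u \in `[t i, t i.+1]%R & f u = v.
      apply: IVT; first exact: ltW.
        exact: continuous_subspaceT.
      by rewrite -/(a i) -/(b i) (ltW av) ltW.
    rewrite in_itv/= => /andP[u1 u2] fu; exists u => _; split=> //.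
    (* Since [v] lies strictly between the two end values, [u] is not a node. Hence points chosen
       for different intervals are distinct, and all of them lie in [[0, 1[]. *)
    rewrite !lt_neqAle u1 u2 !andbT.
    apply/andP; split; apply/eqP => tu.
      move: av vb; rewrite -fu -tu gt_min lt_max !ltxx /= => h /(lt_trans h).
      by rewrite ltxx.
    move: av vb; rewrite -fu tu gt_min lt_max !ltxx !orbF => h /(lt_trans h).
    by rewrite ltxx.
  have [x Hx] := choice H.
  have xi i j : v \in J i -> v \in J j -> x i = x j -> (j <= i)%N.
    move=> /Hx[/andP[i1 i2] _] /Hx[/andP[j1 j2] _] xij.
    rewrite leqNgt; apply/negP => ij.
    have : t i.+1 <= t j by rewrite ler_wpM2r ?invr_ge0// ler_nat.
    by apply/negP; rewrite -ltNge (lt_trans j1)// -xij.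
  have AP i : i \in A -> v \in J i by rewrite finset.in_set.
  have xinj : {in [set i | i \in A] &, injective x}.
    move=> i j /set_mem Ai /set_mem Aj xij; apply/val_inj/anti_leq.
    by rewrite !xi// AP.
  have [A0|/card_gt0P[i0 _]] := posnP #|A|; first by rewrite ler_nat A0.
  rewrite ler_nat -card_le_II; apply: card_le_trans (mult v).
  pose y k := x (nth i0 (enum A) k).
  have yA k : (k < #|A|)%N -> nth i0 (enum A) k \in A.
    by rewrite cardE => kA; rewrite -mem_enum mem_nth.
  have yinj : {in `I_#|A| &, injective y}.
    move=> k l; rewrite !inE/= => kA lA ykl.
    have : nth i0 (enum A) k = nth i0 (enum A) l.
      by apply: xinj ykl; rewrite inE/=; exact: yA.
    by move=> /eqP; rewrite nth_uniq -?cardE ?enum_uniq// => /eqP.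
  have /card_eqPle[_ /card_le_trans] := inj_card_eq yinj; apply.
  apply: subset_card_le => _ [k /= kA <-].
  have : nth i0 (enum A) k \in A by exact: yA.
  rewrite inE => /Hx[]; set i := nth i0 _ _ => /andP[iu ui] fu.
  have n0 : 0 < n%:R :> R by rewrite ltr0n (leq_ltn_trans (leq0n _) (ltn_ord i0)).
  split=> //; apply/andP; split.
    by apply: le_trans (ltW iu); rewrite divr_ge0// ltW.
  by apply: (lt_le_trans ui); rewrite ler_pdivrMr// mul1r ler_nat.
have mJ i : measurable (J i : set (measurableTypeR R)) by exact: measurable_itv.
have mK : measurable (K : set (measurableTypeR R)) by exact: measurable_itv.
have -> : \sum_(i < n) `|f (t i.+1) - f (t i)| = \sum_(i < n) (b i - a i).
  by apply: eq_bigr => i _; rewrite baE.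
rewrite -lee_fin -sumEFin.
have -> : (\sum_(i < n) (b i - a i)%:E =
    \int[mu]_(v in K) (\sum_(i < n) (\1_(J i) v)%:E))%E.
  rewrite ge0_integral_sum//; last first.
    by move=> i; apply/measurable_EFinP; apply: measurable_indic; exact: measurable_itv.
  apply: eq_bigr => i _.
  rewrite integral_indic; [|exact: measurable_itv|exact: measurable_itv].
  rewrite -muJ; congr (mu _); apply/esym/setIidPl => v.
  rewrite /J/K/= !in_itv/= => /andP[av vb].
  have /ler_normlP[]:= fB (t i); have /ler_normlP[] := fB (t i.+1).
  move: av vb; rewrite /a /b gt_min lt_max => /orP[]? /orP[]?; lra.
have <- : (\int[mu]_(v in K) (w%:R)%:E = (w%:R * (B + B))%:E)%E.
  by rewrite integral_cst//= muB EFinM.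
apply: ge0_le_integral => //.
- by move=> v _; apply: sume_ge0 => i _; rewrite lee_fin.
- apply: emeasurable_sum => i.
  by apply/measurable_EFinP; apply: measurable_indic; exact: measurable_itv.
- by move=> v _; rewrite sumEFin lee_fin.
Qed.

End Variation.

(** * Coordinates for curve shortening flow *)

Section PairDerivatives.
Context {R : realType}.
Implicit Types (G : R * R -> R * R) (c : R -> R * R) (t u : R).

Lemma derivable_partial1 G t u : derivable G (t, u) (1, 0) ->
  is_derive t 1 (fun s => G (s, u)) ('D_(1, 0) G (t, u)).
Proof.
move=> dG.
have E : (fun h : R => h^-1 *: (((fun s => G (s, u)) \o shift t) (h *: 1) - G (t, u))) =
         (fun h => h^-1 *: ((G \o shift (t, u)) (h *: (1, 0)) - G (t, u))).
  apply/funext => h /=; congr (_ *: (G _ - _)).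
  by congr pair; rewrite /= scaler0 add0r.
by split; rewrite /derivable /derive E.
Qed.

Lemma derivable_partial2 G t u : derivable G (t, u) (0, 1) ->
  is_derive u 1 (fun v => G (t, v)) ('D_(0, 1) G (t, u)).
Proof.
move=> dG.
have E : (fun h : R => h^-1 *: (((fun v => G (t, v)) \o shift u) (h *: 1) - G (t, u))) =
         (fun h => h^-1 *: ((G \o shift (t, u)) (h *: (0, 1)) - G (t, u))).
  apply/funext => h /=; congr (_ *: (G _ - _)).
  by congr pair; rewrite /= scaler0 add0r.
by split; rewrite /derivable /derive E.
Qed.

Lemma is_derive_cvgP (V : normedModType R) (c : R -> V) t v :
  is_derive t 1 c v <->
  h^-1 *: (c (h *: 1 + t) - c t) @[h --> 0^'] --> v.
Proof.
split=> [[dc <-]|cv]; first exact: dc.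
by apply: DeriveDef; [apply/cvg_ex; exists v|exact: cvg_lim].
Qed.

Lemma is_derive_pairP c t v : is_derive t 1 c v <->
  is_derive t 1 (fst \o c) v.1 /\ is_derive t 1 (snd \o c) v.2.
Proof.
split=> [/is_derive_cvgP cv|[/is_derive_cvgP c1 /is_derive_cvgP c2]].
  split; apply/is_derive_cvgP; case: v cv => v1 v2 cv.
    exact: (cvg_comp _ _ cv (@cvg_fst _ _ (nbhs v1) (nbhs v2) _)).
  exact: (cvg_comp _ _ cv (@cvg_snd _ _ (nbhs v1) (nbhs v2) _)).
by apply/is_derive_cvgP; case: v c1 c2 => v1 v2; apply: cvg_pair.
Qed.

End PairDerivatives.

Section Flow.
Context {R : realType}.
Implicit Types (t u tau : R).

(* The partial derivatives of a function [h t u] of time and parameter which is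
   1-periodic in [u], on the domain [0 <= t < tau]. *)
Record smooth_family tau (h hu huu ht htu : R -> R -> R) : Prop := SmoothFamily {
  family_continuous : forall t u, 0 <= t < tau ->
    [/\ {for (t, u), continuous (fun p => h p.1 p.2)},
        {for (t, u), continuous (fun p => hu p.1 p.2)},
        {for (t, u), continuous (fun p => huu p.1 p.2)},
        {for (t, u), continuous (fun p => ht p.1 p.2)}
      & {for (t, u), continuous (fun p => htu p.1 p.2)}];
  family_u : forall t u, 0 <= t < tau -> is_derive u 1 (h t) (hu t u);
  family_uu : forall t u, 0 <= t < tau -> is_derive u 1 (hu t) (huu t u);
  family_t : forall t u, 0 <= t < tau -> is_derive t 1 (h ^~ u) (ht t u);
  family_tu : forall t u, 0 <= t < tau -> is_derive u 1 (ht t) (htu t u);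
  family_ut : forall t u, 0 <= t < tau -> is_derive t 1 (hu ^~ u) (htu t u);
  family_periodic : forall t u, 0 <= t < tau -> h t (u + 1) = h t u }.

(** Here [g] is the smooth extension of the solution and [q] one of the two coordinate projections,
    so that both coordinates are treated at once. *)
Lemma Ck2_smooth_family tau (U : set (R * R)) (g : R * R -> R * R) (q : R * R -> R) :
  open U -> (forall t u, 0 <= t < tau -> U (t, u)) -> Ck_on 2 U g ->
  (forall t u, 0 <= t < tau -> g (t, u + 1) = g (t, u)) ->
  continuous q ->
  (forall (c : R -> R * R) t v, is_derive t 1 c v -> is_derive t 1 (q \o c) (q v)) ->
  smooth_family tau (fun t u => q (g (t, u)))
    (fun t u => q ('D_(0, 1) g (t, u)))
    (fun t u => q ('D_(0, 1) ('D_(0, 1) g) (t, u)))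
    (fun t u => q ('D_(1, 0) g (t, u)))
    (fun t u => q ('D_(0, 1) ('D_(1, 0) g) (t, u))).
Proof.
move=> oU DU [cg [dg [ct [dt _ ctu]] [cu [du cut cuu]]]] gper cq dq.
have cE (k : R * R -> R * R) t u : {for (t, u), continuous k} ->
    {for (t, u), continuous (fun p => q (k (p.1, p.2)))}.
  move=> ck; rewrite (_ : (fun _ => _) = q \o k); last first.
    by apply/funext => -[].
  by apply: continuous_comp => //; exact: cq.
split=> t u tD; have Utu := DU t u tD.
- split; [exact: (cE g _ _ (cg _ Utu))|exact: (cE _ _ _ (cu _ Utu))
    |exact: (cE _ _ _ (cuu.1 _ Utu))|exact: (cE _ _ _ (ct _ Utu))
    |exact: (cE _ _ _ (ctu.1 _ Utu))].
- exact: (dq _ _ _ (derivable_partial2 (dg _ Utu).2)).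
- exact: (dq _ _ _ (derivable_partial2 (du _ Utu).2)).
- exact: (dq _ _ _ (derivable_partial1 (dg _ Utu).1)).
- exact: (dq _ _ _ (derivable_partial2 (dt _ Utu).2)).
(* [Ck_on] provides the two mixed derivatives separately, while a [smooth_family] has a single one;
   Schwarz's theorem identifies them. *)
- have -> : q ('D_(0, 1) ('D_(1, 0) g) (t, u)) = q ('D_(1, 0) ('D_(0, 1) g) (t, u)).
    have /nbhs_ballP[d /= d0 dU] := open_nbhs_nbhs (conj oU Utu).
    apply: (@mixed_derivatives_eq R (fun t u => q (g (t, u)))
      (fun t u => q ('D_(1, 0) g (t, u))) (fun t u => q ('D_(0, 1) g (t, u)))
      (fun t u => q ('D_(0, 1) ('D_(1, 0) g) (t, u)))
      (fun t u => q ('D_(1, 0) ('D_(0, 1) g) (t, u))) t u d d0).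
    + move=> s v st vu.
      have Usv : U (s, v) by apply: dU; split; rewrite /ball/= distrC.
      split.
      * exact: (dq _ _ _ (derivable_partial1 (dg _ Usv).1)).
      * exact: (dq _ _ _ (derivable_partial2 (dg _ Usv).2)).
      * exact: (dq _ _ _ (derivable_partial2 (dt _ Usv).2)).
      * exact: (dq _ _ _ (derivable_partial1 (du _ Usv).1)).
    + exact: (cE _ _ _ (ctu.1 _ Utu)).
    + exact: (cE _ _ _ (cut.1 _ Utu)).
  exact: (dq _ _ _ (derivable_partial1 (du _ Utu).1)).
- by rewrite gper.
Qed.

Lemma family_u_periodic tau (h hu huu ht htu : R -> R -> R) t :
  smooth_family tau h hu huu ht htu -> 0 <= t < tau -> hu t 1 = hu t 0.
Proof.
move=> sh tD; have d1 : is_derive (0 + 1 : R) 1 (h t) (hu t 1).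
  by rewrite add0r; exact: family_u sh _ _ tD.
have ds : is_derive (0 : R) 1 (fun u => u + 1) 1.
  by have := is_deriveD (is_derive_id (0 : R) 1) (is_derive_cst (1 : R) (0 : R) 1);
    rewrite addr0.
have := @is_derive1_comp _ (h t) (fun u => u + 1) 0 _ _ d1 ds.
rewrite (_ : h t \o _ = h t); last first.
  by apply/funext => u /=; exact: family_periodic sh _ _ tD.
by rewrite mulr1 => -[_ <-]; have [_ <-] := family_u sh 0 tD.
Qed.

(** Periodicity is known only for times in [[0, tau[], so it can be differentiated in time only
    where a two-sided neighbourhood is available, hence [0 < t]. *)
Lemma family_t_periodic tau (h hu huu ht htu : R -> R -> R) t :
  smooth_family tau h hu huu ht htu -> 0 < t < tau -> ht t 1 = ht t 0.
Proof.
move=> sh tD; have tD' : 0 <= t < tau by case/andP: tD => /ltW ->.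
have : is_derive t 1 (h ^~ 0) (ht t 1).
  apply: near_eq_is_derive (family_t sh 1 tD').
  have /near_in_itvoo : t \in `]0, tau[%R by rewrite in_itv.
  apply: filterS => s; rewrite in_itv/= => /andP[/ltW s0 s1].
  by rewrite -[1]add0r (family_periodic sh) ?s0.
by move=> [_ <-]; have [_ <-] := family_t sh 0 tD'.
Qed.

(** With [r] the speed and [k] the signed curvature, [xu * yuu - yu * xuu = k r^3], and the last two
    fields say that the velocity is [k] times the unit normal [(- yu, xu) / r]. *)
Record csf_coordinates tau (x xu xuu xt xtu y yu yuu yt ytu : R -> R -> R) : Prop :=
  CsfCoordinates {
  csf_x : smooth_family tau x xu xuu xt xtu;
  csf_y : smooth_family tau y yu yuu yt ytu;
  csf_regular : forall t u, 0 <= t < tau -> 0 < xu t u ^+ 2 + yu t u ^+ 2;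
  csf_xt : forall t u, 0 < t < tau -> xt t u =
    - yu t u * (xu t u * yuu t u - yu t u * xuu t u) /
    (xu t u ^+ 2 + yu t u ^+ 2) ^+ 2;
  csf_yt : forall t u, 0 < t < tau -> yt t u =
    xu t u * (xu t u * yuu t u - yu t u * xuu t u) /
    (xu t u ^+ 2 + yu t u ^+ 2) ^+ 2 }.

Lemma is_derive_sqrt_comp (f : R -> R) u f' : 0 < f u -> is_derive u 1 f f' ->
  is_derive u 1 (fun v => Num.sqrt (f v)) (f' / (2 * Num.sqrt (f u))).
Proof.
move=> f0 df; have := is_derive1_comp (is_derive1_sqrt f0) df.
by rewrite mulrC.
Qed.

Lemma is_derive_sqr (f : R -> R) u f' : is_derive u 1 f f' ->
  is_derive u 1 (fun v => f v ^+ 2) (2 * f u * f').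
Proof.
move=> df; rewrite (_ : 2 * f u * f' = f u *: f' + f u *: f').
  exact: (is_deriveM df df).
by rewrite /GRing.scale/=; ring.
Qed.

Lemma is_derive_quotient (f g : R -> R) u f' g' : g u != 0 ->
  is_derive u 1 f f' -> is_derive u 1 g g' ->
  is_derive u 1 (fun v => f v / g v) ((f' * g u - f u * g') / g u ^+ 2).
Proof.
move=> g0 df dg; have dV := is_deriveV g0 dg.
apply: is_derive_eq (is_deriveM df dV) _.
by rewrite /GRing.scale/=; field.
Qed.

(** Since [r r' = a a' + b b'], the derivative of [(a, b) / r] collapses to
    [(- b, a) * (a b' - b a') / r^3]; the passage to arclength contributes one more factor
    [1 / r]. *)
Lemma curvature_vectorE (c : R -> R * R) (a a' b b' : R -> R) :
  (forall u, is_derive u 1 (fst \o c) (a u)) ->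
  (forall u, is_derive u 1 (snd \o c) (b u)) ->
  (forall u, is_derive u 1 a (a' u)) -> (forall u, is_derive u 1 b (b' u)) ->
  (forall u, 0 < a u ^+ 2 + b u ^+ 2) ->
  forall u, curvature_vector c u =
    (- b u * (a u * b' u - b u * a' u) / (a u ^+ 2 + b u ^+ 2) ^+ 2,
     a u * (a u * b' u - b u * a' u) / (a u ^+ 2 + b u ^+ 2) ^+ 2).
Proof.
move=> dc1 dc2 da db ab0 u.
have cE : c^`()%classic = (fun u => (a u, b u)).
  apply/funext => v; rewrite derive1E.
  by have [_ ->] : is_derive v 1 c (a v, b v) by apply/is_derive_pairP.
have sE v : speed c v = Num.sqrt (a v ^+ 2 + b v ^+ 2) by rewrite /speed cE.
pose r v := Num.sqrt (a v ^+ 2 + b v ^+ 2).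
have r0 v : 0 < r v by rewrite sqrtr_gt0.
have r2 v : r v ^+ 2 = a v ^+ 2 + b v ^+ 2 by rewrite sqr_sqrtr// ltW.
have dr : is_derive u 1 r ((a u * a' u + b u * b' u) / r u).
  have d2 : is_derive u 1 (fun v => a v ^+ 2 + b v ^+ 2)
      (2 * (a u * a' u + b u * b' u)).
    apply: is_derive_eq (is_deriveD (is_derive_sqr (da u)) (is_derive_sqr (db u))) _.
    by ring.
  apply: is_derive_eq (@is_derive_sqrt_comp _ u _ (ab0 u) d2) _.
  by rewrite -/(r u); field; rewrite gt_eqF.
have tE : unit_tangent c = (fun v => (a v / r v, b v / r v)).
  apply/funext => v; rewrite /unit_tangent cE sE -/(r v).
  by congr pair; rewrite mulrC.
rewrite /curvature_vector tE sE -/(r u) derive1E.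
have ru := r0 u; have r2u := r2 u; rewrite -r2u.
have [_ ->] : is_derive u 1 (fun v => (a v / r v, b v / r v))
    (- b u * (a u * b' u - b u * a' u) / r u ^+ 3,
     a u * (a u * b' u - b u * a' u) / r u ^+ 3).
  have rN0 : r u != 0 by rewrite gt_eqF.
  apply/is_derive_pairP; split.
    apply: is_derive_eq (is_derive_quotient rN0 (da u) dr) _.
    transitivity ((a' u * r u ^+ 2 - a u * (a u * a' u + b u * b' u)) / r u ^+ 3).
      by field.
    by congr (_ / _); rewrite r2u; ring.
  apply: is_derive_eq (is_derive_quotient rN0 (db u) dr) _.
  transitivity ((b' u * r u ^+ 2 - b u * (a u * a' u + b u * b' u)) / r u ^+ 3).
    by field.
  by congr (_ / _); rewrite r2u; ring.
by congr pair; rewrite /GRing.scale/=; field; rewrite gt_eqF.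
Qed.

End Flow.

Section CsfCoordinates.
Context {R : realType}.
Local Notation mu := (@lebesgue_measure R).
Implicit Types (t u tau : R).

(** The coordinates are those of the smooth extension, not of [X], whose values at negative times
    are arbitrary; this gives two-sided time derivatives at 0. The flow equation passes to the
    extension because both agree near every time in []0, tau[]. *)
Lemma csf_solution_coordinates tau (c : R -> R * R) (X : R -> R -> R * R) :
  csf_solution c tau X ->
  exists x xu xuu xt xtu y yu yuu yt ytu,
    csf_coordinates tau x xu xuu xt xtu y yu yuu yt ytu /\
    forall t u, 0 <= t < tau -> X t u = (x t u, y t u).
Proof.
move=> [tau0 _ [U [g [oU DU Ck Xg]]] scc pde].
have {}DU t u : 0 <= t < tau -> U (t, u).
  by move=> tD; apply: DU; split; rewrite //= in_itv.
have {}Xg t u : 0 <= t < tau -> X t u = g (t, u).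
  by move=> tD; apply: (Xg (t, u)); rewrite inE; split; rewrite //= in_itv.
have XE t : 0 <= t < tau -> X t = (fun u => g (t, u)).
  by move=> tD; apply/funext => u; exact: Xg.
have gper t u : 0 <= t < tau -> g (t, u + 1) = g (t, u).
  by move=> tD; rewrite -!Xg//; have [_ _ ->] := scc t tD.
have dq1 (k : R -> R * R) t v : is_derive t 1 k v -> is_derive t 1 (fst \o k) v.1.
  by move=> /is_derive_pairP[].
have dq2 (k : R -> R * R) t v : is_derive t 1 k v -> is_derive t 1 (snd \o k) v.2.
  by move=> /is_derive_pairP[].
have c1 : continuous (@fst R R) by move=> p; exact: cvg_fst.
have c2 : continuous (@snd R R) by move=> p; exact: cvg_snd.
have sx := Ck2_smooth_family oU DU (Ck 2) gper c1 dq1.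
have sy := Ck2_smooth_family oU DU (Ck 2) gper c2 dq2.
have [cg [dg _ _]] := Ck 1.
exists (fun t u => (g (t, u)).1), (fun t u => ('D_(0, 1) g (t, u)).1),
  (fun t u => ('D_(0, 1) ('D_(0, 1) g) (t, u)).1),
  (fun t u => ('D_(1, 0) g (t, u)).1),
  (fun t u => ('D_(0, 1) ('D_(1, 0) g) (t, u)).1),
  (fun t u => (g (t, u)).2), (fun t u => ('D_(0, 1) g (t, u)).2),
  (fun t u => ('D_(0, 1) ('D_(0, 1) g) (t, u)).2),
  (fun t u => ('D_(1, 0) g (t, u)).2),
  (fun t u => ('D_(0, 1) ('D_(1, 0) g) (t, u)).2).
have reg t u : 0 <= t < tau ->
    0 < ('D_(0, 1) g (t, u)).1 ^+ 2 + ('D_(0, 1) g (t, u)).2 ^+ 2.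
  move=> tD; have [_ /(_ u) + _ _] := scc t tD.
  rewrite XE// derive1E.
  have [_ ->] := derivable_partial2 (dg _ (DU t u tD)).2.
  move=> d0; rewrite lt_neqAle addr_ge0 ?sqr_ge0// andbT eq_sym.
  by apply: contra d0; rewrite paddr_eq0 ?sqr_ge0// !sqrf_eq0.
have flow_eq t u : 0 < t < tau -> 'D_(1, 0) g (t, u) = curvature_vector (X t) u.
  move=> /[dup] tD /andP[t0 t1].
  have tD' : 0 <= t < tau by rewrite ltW.
  have [_ d1E] := derivable_partial1 (dg _ (DU t u tD')).1.
  apply: (etrans (esym d1E)); rewrite -(pde t u tD) derive1E.
  apply: near_eq_derive.
  have : t \in `]0, tau[%R by rewrite in_itv/= t0.
  move=> /near_in_itvoo; apply: filterS => s; rewrite in_itv/= => /andP[s0 s1].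
  by rewrite Xg// ltW.
split; last by move=> t u tD; rewrite Xg//; case: (g _).
have curvE t u : 0 < t < tau -> 'D_(1, 0) g (t, u) =
    let a := 'D_(0, 1) g (t, u) in let a' := 'D_(0, 1) ('D_(0, 1) g) (t, u) in
    (- a.2 * (a.1 * a'.2 - a.2 * a'.1) / (a.1 ^+ 2 + a.2 ^+ 2) ^+ 2,
     a.1 * (a.1 * a'.2 - a.2 * a'.1) / (a.1 ^+ 2 + a.2 ^+ 2) ^+ 2).
  move=> tD; have tD' : 0 <= t < tau by case/andP: tD => /ltW -> ->.
  rewrite flow_eq// XE//=.
  apply: (@curvature_vectorE R (fun u => g (t, u))
    (fun u => ('D_(0, 1) g (t, u)).1) (fun u => ('D_(0, 1) ('D_(0, 1) g) (t, u)).1)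
    (fun u => ('D_(0, 1) g (t, u)).2) (fun u => ('D_(0, 1) ('D_(0, 1) g) (t, u)).2)).
  - by move=> v; exact: family_u sx _ _ tD'.
  - by move=> v; exact: family_u sy _ _ tD'.
  - by move=> v; exact: family_uu sx _ _ tD'.
  - by move=> v; exact: family_uu sy _ _ tD'.
  - by move=> v; exact: reg.
by split=> // t u tD; rewrite curvE.
Qed.

End CsfCoordinates.

(** * Length estimate *)

Section Energy.
Context {R : realType}.
Local Notation mu := (@lebesgue_measure R).
Context (tau : R) (x xu xuu xt xtu y yu yuu yt ytu : R -> R -> R).
Context (csf : csf_coordinates tau x xu xuu xt xtu y yu yuu yt ytu).
Implicit Types (t u m : R).

Let sx := csf_x csf.
Let sy := csf_y csf.

(** The anisotropic speed; for [m = 1] it is the Euclidean speed. *)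
Let anorm m t u := Num.sqrt (xu t u ^+ 2 + m * yu t u ^+ 2).

(** Signed curvature times the cube of the speed. *)
Let det t u := xu t u * yuu t u - yu t u * xuu t u.

Let anorm_sqr_gt0 m t u : 0 < m -> 0 <= t < tau -> 0 < xu t u ^+ 2 + m * yu t u ^+ 2.
Proof.
move=> m0 tD; have := csf_regular csf u tD.
have [->|x0 _] := eqVneq (xu t u) 0.
  by rewrite expr0n/= !add0r => ?; rewrite mulr_gt0.
by rewrite ltr_pwDl ?exprn_even_gt0// mulr_ge0 ?sqr_ge0// ltW.
Qed.

Let anorm_gt0 m t u : 0 < m -> 0 <= t < tau -> 0 < anorm m t u.
Proof. by move=> m0 tD; rewrite sqrtr_gt0 anorm_sqr_gt0. Qed.

Let anormK m t u : 0 < m -> 0 <= t < tau ->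
  anorm m t u ^+ 2 = xu t u ^+ 2 + m * yu t u ^+ 2.
Proof. by move=> m0 tD; rewrite sqr_sqrtr// ltW// anorm_sqr_gt0. Qed.

Let is_derive_anorm m t u : 0 < m -> 0 <= t < tau -> is_derive u 1 (anorm m t)
  ((xu t u * xuu t u + m * (yu t u * yuu t u)) / anorm m t u).
Proof.
move=> m0 tD; have dx := is_derive_sqr (family_uu sx u tD).
have dy := is_deriveZ m (is_derive_sqr (family_uu sy u tD)).
have ds := @is_derive_sqrt_comp R _ u _ (anorm_sqr_gt0 u m0 tD) (is_deriveD dx dy).
apply: is_derive_eq ds _.
rewrite /GRing.scale/= -/(anorm m t u); field.
by rewrite gt_eqF// anorm_gt0.
Qed.

(** The functions [xu / anorm] and [m * yu / anorm] are the components of the gradient of the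
    anisotropic norm at [(xu, yu)]. This gradient is homogeneous of degree 0, so its variation
    ignores the tangential part of [(xuu, yuu)] and only [det] survives. For [m = 1] it is the unit
    tangent. *)
Let is_derive_gradient1 m t u : 0 < m -> 0 <= t < tau ->
  is_derive u 1 (fun u => xu t u / anorm m t u)
    (- m * yu t u * det t u / anorm m t u ^+ 3).
Proof.
move=> m0 tD; have anN0 : anorm m t u != 0 by rewrite gt_eqF// anorm_gt0.
apply: is_derive_eq
  (is_derive_quotient anN0 (family_uu sx u tD) (is_derive_anorm u m0 tD)) _.
transitivity ((xuu t u * anorm m t u ^+ 2 - xu t u *
  (xu t u * xuu t u + m * (yu t u * yuu t u))) / anorm m t u ^+ 3); first by field.
by congr (_ / _); rewrite anormK// /det; ring.
Qed.

Let is_derive_gradient2 m t u : 0 < m -> 0 <= t < tau ->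
  is_derive u 1 (fun u => m * yu t u / anorm m t u)
    (m * xu t u * det t u / anorm m t u ^+ 3).
Proof.
move=> m0 tD; have anN0 : anorm m t u != 0 by rewrite gt_eqF// anorm_gt0.
have dy : is_derive u 1 (fun u => m * yu t u) (m * yuu t u).
  rewrite (_ : (fun u => _) = m *: yu t)//.
  exact: (is_deriveZ m (family_uu sy u tD)).
apply: is_derive_eq (is_derive_quotient anN0 dy (is_derive_anorm u m0 tD)) _.
transitivity (m * (yuu t u * anorm m t u ^+ 2 - yu t u *
  (xu t u * xuu t u + m * (yu t u * yuu t u))) / anorm m t u ^+ 3); first by field.
by congr (_ / _); rewrite anormK// /det; ring.
Qed.

Let continuous_section (h : R -> R -> R) t :
  (forall u, {for (t, u), continuous (fun p => h p.1 p.2)}) -> continuous (h t).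
Proof.
move=> ch u.
have tv : (t, v) @[v --> u] --> (t, u).
  by apply: (@cvg_pair _ _ _ _ (nbhs t) (nbhs u)); [exact: cvg_cst|exact: cvg_id].
exact: (cvg_comp _ _ tv (ch u)).
Qed.

Lemma anisotropic_norm_continuous m t u : 0 <= t < tau ->
  {for (t, u), continuous (fun p => Num.sqrt (xu p.1 p.2 ^+ 2 + m * yu p.1 p.2 ^+ 2))}.
Proof.
move=> tD; have [_ cxu _ _ _] := family_continuous sx u tD.
have [_ cyu _ _ _] := family_continuous sy u tD.
apply: (@continuous_comp _ _ _
  (fun p => xu p.1 p.2 ^+ 2 + m * yu p.1 p.2 ^+ 2)); last first.
  exact: sqrt_continuous.
by apply: cvgD; [exact: cvgM|apply: cvgM; [exact: cvg_cst|exact: cvgM]].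
Qed.

Lemma anisotropic_norm_time_derive_continuous m t u : 0 < m -> 0 <= t < tau ->
  {for (t, u), continuous (fun p =>
    (xu p.1 p.2 * xtu p.1 p.2 + m * (yu p.1 p.2 * ytu p.1 p.2)) / anorm m p.1 p.2)}.
Proof.
move=> m0 tD; have [_ cxu _ _ cxtu] := family_continuous sx u tD.
have [_ cyu _ _ cytu] := family_continuous sy u tD.
apply: cvgM.
  by apply: cvgD; [exact: cvgM|apply: cvgM; [exact: cvg_cst|exact: cvgM]].
apply: cvgV; first by rewrite gt_eqF// anorm_gt0.
exact: anisotropic_norm_continuous.
Qed.

(** First variation: integrating by parts puts the [u]-derivative on the gradient of the norm. That
    derivative and the velocity are both multiples of [(- yu, xu)], with factors [m det / anorm^3]
    and [det / r^4], so their product is nonnegative. For [m = 1] the integral is that of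
    [k^2 ds]. *)
Lemma is_derive_anisotropic_energy m t : 0 < m -> 0 < t < tau ->
  is_derive t 1 (fun s => \int[mu]_(u in `[0, 1]) anorm m s u)
    (- \int[mu]_(u in `[0, 1]) (m * det t u ^+ 2 /
         ((xu t u ^+ 2 + yu t u ^+ 2) * anorm m t u ^+ 3))).
Proof.
move=> m0 /andP[t0 t1].
have tD : 0 <= t < tau by rewrite ltW.
(* A compact time interval inside []0, tau[] around [t], on which the time derivative of the
   integrand is bounded. *)
pose a := t / 2; pose b := (t + tau) / 2.
have abD s : a <= s <= b -> 0 <= s < tau.
  by rewrite /a /b => /andP[h1 h2]; apply/andP; split; lra.
have tab : t \in `]a, b[%R by rewrite in_itv/= /a /b; apply/andP; split; lra.
have itvab s : `]a, b[ s -> 0 <= s < tau.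
  by rewrite /= in_itv/= => /andP[/ltW h1 /ltW h2]; apply: abD; rewrite h1.
pose df s u := (xu s u * xtu s u + m * (yu s u * ytu s u)) / anorm m s u.
have dfE s u : 0 <= s < tau -> is_derive s 1 (anorm m ^~ u) (df s u).
  move=> sD.
  have dx := is_derive_sqr (family_ut sx u sD).
  have dy := is_deriveZ m (is_derive_sqr (family_ut sy u sD)).
  have ds := @is_derive_sqrt_comp R _ s _ (anorm_sqr_gt0 u m0 sD) (is_deriveD dx dy).
  apply: is_derive_eq ds _.
  rewrite /df /GRing.scale/= -/(anorm m s u); field.
  by rewrite gt_eqF// anorm_gt0.
have [M HM] := @bounded_on_box R (fun p => df p.1 p.2) a b
  (fun s u sab _ => anisotropic_norm_time_derive_continuous m0 (abD s sab)).
have M0 : 0 <= M.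
  apply: (le_trans (normr_ge0 _)); apply: (HM t 0); rewrite ?lexx ?ler01//.
  by move: tab; rewrite in_itv/= => /andP[/ltW -> /ltW].
have ca s : 0 <= s < tau -> continuous (anorm m s).
  by move=> sD; apply: continuous_section => u; exact: anisotropic_norm_continuous.
have intf s : `]a, b[ s -> mu.-integrable `[0, 1] (EFin \o anorm m s).
  by move=> /itvab sD; apply: continuous_integrable01; exact: ca.
have derf s u : `]a, b[ s -> `[0, 1] u -> derivable (anorm m ^~ u) s 1.
  by move=> /itvab sD _; have [] := dfE s u sD.
have d1E s u : `]a, b[ s -> `[0, 1] u -> partial1of2 (anorm m) s u = df s u.
  by move=> /itvab sD _; rewrite partial1of2E; have [_ ->] := dfE s u sD.
have intM : mu.-integrable `[0, 1] (EFin \o cst M).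
  by apply: continuous_integrable01 => u; exact: cvg_cst.
have Gub s u : `]a, b[ s -> `[0, 1] u -> `|partial1of2 (anorm m) s u| <= cst M u.
  move=> sab u01; rewrite d1E//; apply: HM.
    by move: sab; rewrite /= in_itv/= => /andP[/ltW -> /ltW].
  by move: u01; rewrite /= in_itv.
have m01 : measurable (`[0, 1] : set (measurableTypeR R)) by exact: measurable_itv.
have dE := @differentiation_under_integral R _ _ mu (anorm m) `[0, 1] m01 t a b tab
  intf derf (cst M) (fun=> M0) intM Gub.
have dF := @derivable_under_integral R _ _ mu (anorm m) `[0, 1] m01 t a b tab
  intf derf (cst M) (fun=> M0) intM Gub.
apply: DeriveDef; first exact: dF.
rewrite -derive1E dE {dE dF}.
have -> : \int[mu]_(u in `[0, 1]) partial1of2 (anorm m) t u =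
    \int[mu]_(u in `[0, 1]) (xu t u / anorm m t u * xtu t u +
      m * yu t u / anorm m t u * ytu t u).
  apply: eq_Rintegral => u /set_mem u01; rewrite d1E//.
  by rewrite /df; field; rewrite gt_eqF// anorm_gt0.
have cc (h hu huu ht htu : R -> R -> R) : smooth_family tau h hu huu ht htu ->
    [/\ continuous (hu t), continuous (huu t), continuous (ht t) & continuous (htu t)].
  move=> sh; split; apply: continuous_section => u;
  by have [] := family_continuous sh u tD.
have [cxu cxuu cxt cxtu] := cc _ _ _ _ _ sx.
have [cyu cyuu cyt cytu] := cc _ _ _ _ _ sy.
have can := ca _ tD.
have cVan : continuous (fun u => (anorm m t u)^-1).
  by move=> u; apply: cvgV; [rewrite gt_eqF// anorm_gt0|exact: can].
have cM (f g : R -> R) : continuous f -> continuous g -> continuous (fun u => f u * g u).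
  by move=> cf cg u; apply: cvgM; [exact: cf|exact: cg].
have cD (f g : R -> R) : continuous f -> continuous g -> continuous (fun u => f u + g u).
  by move=> cf cg u; apply: cvgD; [exact: cf|exact: cg].
have cN (f : R -> R) : continuous f -> continuous (fun u => - f u).
  by move=> cf u; apply: cvgN; exact: cf.
have cC (k : R) : continuous (fun _ : R => k) by move=> u; exact: cvg_cst.
rewrite integral01D; [|by apply: (cM _ _ (cM _ _ cxu cVan) cxtu)|
  by apply: (cM _ _ (cM _ _ (cM _ _ (cC m) cyu) cVan) cytu)].
have cdet : continuous (det t).
  exact: (cD _ _ (cM _ _ cxu cyuu) (cN _ (cM _ _ cyu cxuu))).
have tD' : 0 < t < tau by rewrite t0.
have xu1 := family_u_periodic sx tD; have xt1 := family_t_periodic sx tD'.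
have yu1 := family_u_periodic sy tD; have yt1 := family_t_periodic sy tD'.
have an1 : anorm m t 1 = anorm m t 0 by rewrite /anorm xu1 yu1.
have anN0 u : anorm m t u != 0 by rewrite gt_eqF// anorm_gt0.
have dP1 u := is_derive_gradient1 u m0 tD.
have dP2 u := is_derive_gradient2 u m0 tD.
have cP (h : R -> R) : continuous h -> continuous (fun u => h u / anorm m t u ^+ 3).
  move=> ch u; apply: cvgM; first exact: ch.
  apply: cvgV; first by rewrite expf_neq0.
  by apply: cvgM; [exact: can|apply: cvgM; exact: can].
have cP1 := cP _ (cM _ _ (cM _ _ (cC (- m)) cyu) cdet).
have cP2 := cP _ (cM _ _ (cM _ _ (cC m) cxu) cdet).
have dxt u := family_tu sx u tD; have dyt u := family_tu sy u tD.
have P11 : xu t 1 / anorm m t 1 = xu t 0 / anorm m t 0 by rewrite xu1 an1.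
have P21 : m * yu t 1 / anorm m t 1 = m * yu t 0 / anorm m t 0 by rewrite yu1 an1.
rewrite (integration_by_parts_periodic dP1 dxt cP1 cxtu P11 xt1).
rewrite (integration_by_parts_periodic dP2 dyt cP2 cytu P21 yt1).
rewrite -opprD -integral01D; [|exact: (cM _ _ cP1 cxt)|exact: (cM _ _ cP2 cyt)].
congr (- _); apply: eq_Rintegral => u _.
rewrite (csf_xt csf)// (csf_yt csf)// -/(det t u).
have reg := csf_regular csf u tD.
by field; rewrite anN0 /= gt_eqF.
Qed.

Lemma anisotropic_energy_nincr m s t : 0 < m -> 0 < s -> s <= t -> t < tau ->
  \int[mu]_(u in `[0, 1]) anorm m t u <= \int[mu]_(u in `[0, 1]) anorm m s u.
Proof.
move=> m0 s0 st tT.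
have dE v : s <= v <= t -> 0 < v < tau.
  by move=> /andP[sv vt]; rewrite (lt_le_trans s0 sv) (le_lt_trans vt tT).
apply: (@ler0_derive1_nincr _
  (fun v => \int[mu]_(u in `[0, 1]) anorm m v u) s t) => //.
- move=> v; rewrite in_itv/= => /andP[/ltW sv /ltW vt].
  by have [|//] := @is_derive_anisotropic_energy m v m0; apply: dE; rewrite sv.
- move=> v; rewrite in_itv/= => /andP[/ltW sv /ltW vt].
  have vD : 0 < v < tau by apply: dE; rewrite sv.
  rewrite derive1E; have [_ ->] := is_derive_anisotropic_energy m0 vD.
  rewrite oppr_le0; apply: Rintegral_ge0 => u _.
  have vD' : 0 <= v < tau by case/andP: vD => /ltW ->.
  rewrite divr_ge0// mulr_ge0 ?sqr_ge0 ?(ltW m0)//.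
    by rewrite ltW// (csf_regular csf).
  by rewrite exprn_ge0// sqrtr_ge0.
- apply: derivable_within_continuous => v; rewrite in_itv/= => /dE vD.
  by have [] := is_derive_anisotropic_energy m0 vD.
Qed.

Let csection (h hu huu ht htu : R -> R -> R) t : smooth_family tau h hu huu ht htu ->
  0 <= t < tau -> [/\ continuous (h t), continuous (hu t) & continuous (huu t)].
Proof.
move=> sh tD; split; apply: continuous_section => u;
by have [] := family_continuous sh u tD.
Qed.

(** With [m = d ^+ 2], the norm lies between [|xu|] and [|xu| + d |yu|]; the lower bound is used at
    time [t] and the upper one at time 0, with the monotone energy in between. *)
Lemma horizontal_variation_le t : 0 < t < tau ->
  \int[mu]_(u in `[0, 1]) `|xu t u| <= \int[mu]_(u in `[0, 1]) `|xu 0 u|.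
Proof.
move=> /andP[t0 tT]; have tau0 := lt_trans t0 tT.
have D0 : 0 <= (0 : R) < tau by apply/andP; split.
have Dt : 0 <= t < tau by rewrite ltW.
have [_ cx0 _] := csection sx D0; have [_ cy0 _] := csection sy D0.
have [_ cxt _] := csection sx Dt.
have cnorm (f : R -> R) : continuous f -> continuous (fun u => `|f u|).
  by move=> cf u; apply: cvg_norm; exact: cf.
have ca m s : 0 <= s < tau -> continuous (anorm m s).
  by move=> sD; apply: continuous_section => u; exact: anisotropic_norm_continuous.
set Y := \int[mu]_(u in `[0, 1]) `|yu 0 u|.
have Y0 : 0 <= Y by apply: Rintegral_ge0 => u _; exact: normr_ge0.
apply/ler_addgt0Pr => e e0.
(* Makes [d * Y <= e / 2]; the other half of [e] pays for the passage from time 0 to a small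
   positive time [s]. *)
pose d := e / 2 / (Y + 1).
have d0 : 0 < d by rewrite !divr_gt0// ltr_wpDl.
have m0 : 0 < d ^+ 2 by rewrite exprn_gt0.
have e2 : 0 < e / 2 by rewrite divr_gt0.
have : \forall s \near (0 : R), forall u : R, 0 <= u <= 1 ->
    `|anorm (d ^+ 2) s u - anorm (d ^+ 2) 0 u| < e / 2.
  apply: (@near_uniform01 R (fun p => anorm (d ^+ 2) p.1 p.2)) => // u _.
  exact: anisotropic_norm_continuous.
move=> /nbhs_ballP[r /= r0 Hr].
pose s := Num.min t (r / 2).
have s0 : 0 < s by rewrite lt_min t0 divr_gt0.
have st : s <= t by rewrite ge_min lexx.
have sr : s < r.
  by rewrite gt_min ltr_pdivrMr// ltr_pMr// ltr1n orbT.
have Ds : 0 <= s < tau by rewrite ltW//= (le_lt_trans st).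
have {}Hr u : 0 <= u <= 1 -> anorm (d ^+ 2) s u <= anorm (d ^+ 2) 0 u + e / 2.
  move=> u01; have : ball 0 r s by rewrite /ball/= sub0r normrN gtr0_norm.
  by move=> /Hr/(_ u u01); rewrite ltr_distl => /andP[_ /ltW].
apply: (@le_trans _ _ (\int[mu]_(u in `[0, 1]) anorm (d ^+ 2) t u)).
  apply: le_integral01; [exact: cnorm|exact: ca|move=> u _].
  by rewrite -sqrtr_sqr ler_wsqrtr// lerDl mulr_ge0 ?sqr_ge0.
apply: (le_trans (anisotropic_energy_nincr m0 s0 st tT)).
have ce : continuous (fun _ : R => e / 2) by move=> u; exact: cvg_cst.
have cdy : continuous (fun u => d * `|yu 0 u|).
  by move=> u; apply: cvgM; [exact: cvg_cst|exact: cnorm].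
have cxdy : continuous (fun u => `|xu 0 u| + d * `|yu 0 u|).
  by move=> u; apply: cvgD; [exact: cnorm|exact: cdy].
apply: (@le_trans _ _ (\int[mu]_(u in `[0, 1])
    ((`|xu 0 u| + d * `|yu 0 u|) + e / 2))).
  apply: le_integral01; first exact: ca.
    by move=> u; apply: cvgD; [exact: cxdy|exact: cvg_cst].
  move=> u u01; apply: (le_trans (Hr u u01)); rewrite lerD2r.
  have xdy0 : 0 <= `|xu 0 u| + d * `|yu 0 u| by rewrite addr_ge0// mulr_ge0// ltW.
  rewrite -[leRHS]ger0_norm// -sqrtr_sqr ler_wsqrtr//.
  have -> : (`|xu 0 u| + d * `|yu 0 u|) ^+ 2 =
      (xu 0 u ^+ 2 + d ^+ 2 * yu 0 u ^+ 2) + 2 * (`|xu 0 u| * (d * `|yu 0 u|)).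
    rewrite -(real_normK (num_real (xu 0 u))) -(real_normK (num_real (yu 0 u))).
    by ring.
  rewrite lerDl; do 2 apply: mulr_ge0 => //.
  by apply: mulr_ge0 => //; exact: ltW.
rewrite integral01D// integral01D; [|exact: cnorm|exact: cdy].
rewrite integral01Z; last exact: cnorm.
rewrite integral01_cst -/Y -addrA lerD2l [leRHS]splitr lerD2r.
rewrite /d mulrAC ler_pdivrMr ?ltr_wpDl// ler_pM2l//.
by rewrite lerDl.
Qed.

(** Where [yu = 0], the flow equation reduces to [yt = yuu / xu^2], so [yt] has the sign of [yuu];
    the maximum principle applies to both [y] and [- y]. *)
Lemma height_le (D : R) : (forall u, `|y 0 u| <= D) ->
  forall t u, 0 <= t < tau -> 0 <= u <= 1 -> `|y t u| <= D.
Proof.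
move=> y0 t u tD u01; have [t0 tT] := andP tD.
have le_tau s : 0 <= s <= t -> 0 <= s < tau.
  by move=> /andP[-> /le_lt_trans]; exact.
have lt_tau s : 0 < s <= t -> 0 < s < tau.
  by move=> /andP[-> /le_lt_trans]; exact.
have ltW_tau s : 0 < s <= t -> 0 <= s < tau.
  by move=> /andP[/ltW ? ?]; apply: le_tau; apply/andP.
have flat s v : 0 < s <= t -> yu s v = 0 ->
    yt s v = xu s v ^+ 2 * yuu s v / (xu s v ^+ 2) ^+ 2.
  move=> sT yu0; rewrite (csf_yt csf) ?lt_tau// yu0.
  by rewrite mul0r subr0 expr0n/= addr0 mulrA -expr2.
have tt : 0 <= t <= t by rewrite t0 lexx.
rewrite ler_norml; apply/andP; split.
  rewrite lerNl.
  apply: (@maximum_principle R (fun t u => - y t u) (fun t u => - yu t u)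
    (fun t u => - yuu t u) (fun t u => - yt t u) t D) => //.
  - move=> s v /le_tau sD; have [cy _ _ _ _] := family_continuous sy v sD.
    exact: cvgN.
  - by move=> s v /le_tau sD; rewrite (family_periodic sy).
  - move=> s v /ltW_tau sD; split.
    + exact: (is_deriveN (family_t sy v sD)).
    + exact: (is_deriveN (family_u sy v sD)).
    + exact: (is_deriveN (family_uu sy v sD)).
  - move=> s v sD /eqP; rewrite oppr_eq0 => /eqP yu0; rewrite !oppr_le0 => yuu0.
    rewrite flat//; apply: divr_ge0; last exact: sqr_ge0.
    by apply: mulr_ge0 => //; exact: sqr_ge0.
  - by move=> v; have := y0 v; rewrite ler_norml lerNl => /andP[].
apply: (@maximum_principle R y yu yuu yt t D) => //.
- by move=> s v /le_tau sD; have [cy _ _ _ _] := family_continuous sy v sD.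
- by move=> s v /le_tau sD; rewrite (family_periodic sy).
- move=> s v /ltW_tau sD; split.
  + exact: (family_t sy v sD).
  + exact: (family_u sy v sD).
  + exact: (family_uu sy v sD).
- move=> s v sD yu0 yuu0; rewrite flat//.
  apply: mulr_le0_ge0; last by rewrite invr_ge0 sqr_ge0.
  by apply: mulr_ge0_le0 => //; exact: sqr_ge0.
- by move=> v; have := y0 v; rewrite ler_norml => /andP[].
Qed.

(** Completing the square. It is used with [a = |xu|], [b = |det|] and [n] the speed: the left side
    is then the density of [|k T1| ds], and the right side that of [l / 2 * k^2 ds] plus
    [|xu| / (2 l)]. *)
Let young_bound (a b n l : R) : 0 <= a -> a <= n -> 0 < n -> 0 < l ->
  a * b / n ^+ 3 <= l / 2 * (1 * b ^+ 2 / (n ^+ 2 * n ^+ 3)) + (2 * l)^-1 * a.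
Proof.
move=> a0 an n0 l0.
have n0' : n != 0 by rewrite gt_eqF.
have l0' : l != 0 by rewrite gt_eqF.
rewrite -subr_ge0 (_ : _ - _ =
  ((l * b / n ^+ 2 - a) ^+ 2 + a * (n - a)) / (2 * l * n)); last first.
  by field; rewrite n0' l0'.
apply: divr_ge0; last by rewrite !mulr_ge0// ltW.
by rewrite addr_ge0 ?sqr_ge0// mulr_ge0// subr_ge0.
Qed.

(** The density of [k^2 ds], written as the integrand of the energy derivative at [m = 1]. *)
Let dissipation t u : R :=
  1 * det t u ^+ 2 / ((xu t u ^+ 2 + yu t u ^+ 2) * anorm 1 t u ^+ 3).

(* Integrating by parts, [int yu T2 = - int y (T2)_u] where [T2] is the vertical
   component of the unit tangent, and [|(T2)_u| = |xu| |det| / r ^ 3]. The weight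
   [l] in Young's inequality is the optimal one. *)
Lemma length_excess_sqr_le t C D : 0 < t < tau -> 0 < C -> 0 < D ->
  \int[mu]_(u in `[0, 1]) `|xu t u| <= C ->
  (forall u, 0 <= u <= 1 -> `|y t u| <= D) ->
  C < \int[mu]_(u in `[0, 1]) anorm 1 t u ->
  (\int[mu]_(u in `[0, 1]) anorm 1 t u - C) ^+ 2 <=
  D ^+ 2 * C * \int[mu]_(u in `[0, 1]) dissipation t u.
Proof.
move=> /andP[t0 tT] C0 D0 xC yD CL.
have tD : 0 <= t < tau by rewrite ltW.
set L := \int[mu]_(u in `[0, 1]) anorm 1 t u in CL *.
set Q := \int[mu]_(u in `[0, 1]) dissipation t u.
have LC : 0 < L - C by rewrite subr_gt0.
pose l := D * C / (L - C).
have l0 : 0 < l by rewrite divr_gt0// mulr_gt0.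
have one0 : (0 : R) < 1 by [].
have [cx cxu cxuu] := csection sx tD; have [cy cyu cyuu] := csection sy tD.
have cM (f g : R -> R) : continuous f -> continuous g -> continuous (fun u => f u * g u).
  by move=> cf cg u; apply: cvgM; [exact: cf|exact: cg].
have cD (f g : R -> R) : continuous f -> continuous g -> continuous (fun u => f u + g u).
  by move=> cf cg u; apply: cvgD; [exact: cf|exact: cg].
have cC (k : R) : continuous (fun _ : R => k) by move=> u; exact: cvg_cst.
have cV (f : R -> R) : (forall u, f u != 0) -> continuous f ->
    continuous (fun u => (f u)^-1).
  by move=> f0 cf u; apply: cvgV; [exact: f0|exact: cf].
have can : continuous (anorm 1 t).
  by apply: continuous_section => u; exact: anisotropic_norm_continuous.
have anN0 u : anorm 1 t u != 0 by rewrite gt_eqF// anorm_gt0.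
have can3 : continuous (fun u => anorm 1 t u ^+ 3).
  exact: (cM _ _ can (cM _ _ can can)).
have cdet : continuous (det t).
  by move=> u; apply: cvgB; [exact: (cM _ _ cxu cyuu)|exact: (cM _ _ cyu cxuu)].
have cax : continuous (fun u => `|xu t u|).
  by move=> u; apply: cvg_norm; exact: cxu.
have an2 u : anorm 1 t u ^+ 2 = xu t u ^+ 2 + yu t u ^+ 2.
  by rewrite anormK// mul1r.
have cf : continuous (fun u => 1 * xu t u * det t u / anorm 1 t u ^+ 3).
  apply: (cM _ _ (cM _ _ (cM _ _ (cC 1) cxu) cdet)).
  by apply: cV => [u|//]; rewrite expf_neq0.
have cT2 : continuous (fun u => 1 * yu t u / anorm 1 t u).
  by apply: (cM _ _ (cM _ _ (cC 1) cyu)); exact: cV.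
have cq : continuous (dissipation t).
  apply: (cM _ _ (cM _ _ (cC 1) (cM _ _ cdet cdet))); apply: cV => [u|].
    by rewrite -an2 mulf_neq0// expf_neq0.
  by apply: (cM _ _ _ can3); apply: (cD _ _); apply: (cM _ _).
have yu1 : y t 1 = y t 0 by rewrite -[1]add0r (family_periodic sy).
have T21 : 1 * yu t 1 / anorm 1 t 1 = 1 * yu t 0 / anorm 1 t 0.
  by rewrite /anorm (family_u_periodic sx tD) (family_u_periodic sy tD).
have ibp := integration_by_parts_periodic (fun u => is_derive_gradient2 u one0 tD)
  (fun u => family_u sy u tD) cf cyu T21 yu1.
(* Pointwise the speed [r] equals [xu^2 / r + yu^2 / r], and [xu^2 / r <= |xu|]. *)
have L1 : L <= C + \int[mu]_(u in `[0, 1]) (1 * yu t u / anorm 1 t u * yu t u).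
  apply: (@le_trans _ _ (\int[mu]_(u in `[0, 1])
      (`|xu t u| + 1 * yu t u / anorm 1 t u * yu t u))); last first.
    by rewrite integral01D ?lerD2r//; exact: (cM _ _).
  apply: le_integral01 => //; first by apply: (cD _ _) => //; exact: (cM _ _).
  move=> u _; have n0 := anorm_gt0 u one0 tD.
  have xn : `|xu t u| <= anorm 1 t u.
    by rewrite -sqrtr_sqr ler_wsqrtr// lerDl mulr_ge0 ?sqr_ge0.
  rewrite -subr_ge0 (_ : _ - _ = `|xu t u| * (anorm 1 t u - `|xu t u|) / anorm 1 t u).
    by rewrite divr_ge0 ?(ltW n0)// mulr_ge0// subr_ge0.
  have := an2 u; rewrite -(real_normK (num_real (xu t u))) => e2.
  transitivity ((`|xu t u| * anorm 1 t u + yu t u ^+ 2 - anorm 1 t u ^+ 2) / anorm 1 t u).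
    by field.
  by congr (_ / _); rewrite e2; ring.
have L2 : \int[mu]_(u in `[0, 1]) (1 * yu t u / anorm 1 t u * yu t u) <=
    D * (l / 2 * Q + (2 * l)^-1 * C).
  rewrite ibp.
  apply: (@le_trans _ _ (D * (l / 2 * Q +
      (2 * l)^-1 * \int[mu]_(u in `[0, 1]) `|xu t u|))); last first.
    by rewrite ler_pM2l// lerD2l ler_pM2l// invr_gt0 mulr_gt0.
  rewrite -!integral01Z// -integral01D; [|exact: (cM _ _)|exact: (cM _ _)].
  rewrite -integral01Z; last by apply: (cD _ _); exact: (cM _ _).
  rewrite -[leLHS]mulN1r -integral01Z; last exact: (cM _ _).
  apply: le_integral01; first by apply: (cM _ _) => //; exact: (cM _ _).
    by apply: (cM _ _) => //; apply: (cD _ _); exact: (cM _ _).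
  move=> u u01; have n0 := anorm_gt0 u one0 tD.
  have xn : `|xu t u| <= anorm 1 t u.
    by rewrite -sqrtr_sqr ler_wsqrtr// lerDl mulr_ge0 ?sqr_ge0.
  apply: (@le_trans _ _ (D * (`|xu t u| * `|det t u| / anorm 1 t u ^+ 3))).
    rewrite mulN1r (le_trans (ler_norm _))// normrN !normrM normr1 mul1r mulrC.
    rewrite normfV [`|anorm 1 t u ^+ 3|]gtr0_norm ?exprn_gt0//.
    by apply: ler_wpM2r; [rewrite !mulr_ge0// invr_ge0 exprn_ge0// ltW|exact: yD].
  rewrite ler_pM2l//; apply: (le_trans (young_bound _ _ xn n0 l0)) => //.
  by rewrite /dissipation -an2 real_normK// num_real.
have : L - C <= D * (l / 2 * Q + (2 * l)^-1 * C).
  by rewrite lerBlDl; apply: (le_trans L1); rewrite lerD2l.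
(* The choice of [l] makes the second term exactly half of [L - C], which the left side absorbs. *)
have -> : D * (l / 2 * Q + (2 * l)^-1 * C) =
    (D ^+ 2 * C * Q / (L - C) + (L - C)) / 2.
  by rewrite /l; field; rewrite !gt_eqF.
by rewrite ler_pdivlMr// mulr_natr mulr2n lerD2r ler_pdivlMr// -expr2.
Qed.

Lemma csf_length_le t B C : 0 < t < tau -> 0 < C ->
  (forall u, `|y 0 u| <= B) -> \int[mu]_(u in `[0, 1]) `|xu 0 u| <= C ->
  \int[mu]_(u in `[0, 1]) Num.sqrt (xu t u ^+ 2 + yu t u ^+ 2) <=
    C + (B + 1) ^+ 2 * C / t.
Proof.
move=> /andP[t0 tT] C0 y0B x0C.
have B0 : 0 <= B by rewrite (le_trans _ (y0B 0)).
(* The height bound is enlarged to [B + 1] because the Riccati constant must be positive, while [B]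
   may be 0. *)
have D0 : 0 < B + 1 by rewrite ltr_wpDl.
have one0 : (0 : R) < 1 by [].
have tau_ s : 0 < s <= t -> 0 < s < tau.
  by move=> /andP[-> /le_lt_trans]; exact.
have -> : \int[mu]_(u in `[0, 1]) Num.sqrt (xu t u ^+ 2 + yu t u ^+ 2) =
    \int[mu]_(u in `[0, 1]) anorm 1 t u.
  by apply: eq_Rintegral => u _; rewrite /anorm mul1r.
apply: (@riccati_bound R (fun s => \int[mu]_(u in `[0, 1]) anorm 1 s u)
  (fun s => \int[mu]_(u in `[0, 1]) dissipation s u)) => //.
- by rewrite mulr_gt0// exprn_gt0.
- by move=> s /tau_ sD; exact: is_derive_anisotropic_energy.
- move=> s /tau_ sD; apply: Rintegral_ge0 => u _.
  have sD' : 0 <= s < tau by case/andP: sD => /ltW ->.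
  apply: divr_ge0; first by rewrite mul1r sqr_ge0.
  apply: mulr_ge0; first by rewrite ltW// (csf_regular csf).
  by rewrite exprn_ge0// sqrtr_ge0.
- move=> s /tau_ sD Ls; apply: length_excess_sqr_le => //.
    exact: le_trans (horizontal_variation_le sD) x0C.
  move=> u u01; have sD' : 0 <= s < tau by case/andP: sD => /ltW ->.
  by apply: (le_trans (height_le y0B sD' u01)); rewrite lerDl.
Qed.

End Energy.

(** * Length bound from the multiplicity on vertical lines and a coordinate bound *)

Section LengthBound.
Context {R : realType}.
Local Notation mu := (@lebesgue_measure R).

Lemma periodic_continuous_bounded (f : R -> R) : continuous f ->
  (forall u, f (u + 1) = f u) -> exists M, forall u, `|f u| <= M.
Proof.
move=> cf per.
have perz (k : int) u : f (u + k%:~R) = f u.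
  have pern (n : nat) v : f (v + n%:R) = f v.
    by elim: n v => [|n IH] v; rewrite ?addr0// -[n.+1]addn1 natrD addrA per IH.
  case: k => n; first exact: pern.
  by rewrite NegzE mulrNz -[in RHS](subrK n.+1%:R u) pern.
have : compact (f @` `[0, 1]).
  by apply: continuous_compact; [exact: continuous_subspaceT|exact: segment_compact].
move=> /compact_bounded[M [_ /(_ (M + 1))]]; rewrite ltrDl ltr01 => /(_ isT) H.
exists (M + 1) => u; rewrite -(perz (- Num.floor u)).
apply: H => /=; exists (u + (- Num.floor u)%:~R) => //.
have /andP[fl lf] := floor_itv u.
rewrite in_itv/= mulrNz subr_ge0 fl/= lerBlDl ltW//.
by move: lf; rewrite intrD.
Qed.

(** By simplicity of the curve, the parameters in [[0, 1[] with a given first coordinate inject into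
    the points of the curve on one vertical line, so every level set has at most [w] elements. *)
Lemma horizontal_variation_omega_graph (w : nat) (B : R) (c : R -> R * R) (a : R -> R) :
  smooth_closed_curve c -> omega_graph w c ->
  (forall u : R, is_derive u 1 (fst \o c) (a u)) -> continuous a ->
  (forall u, `|(c u).1| <= B) ->
  \int[mu]_(u in `[0, 1]) `|a u| <= w%:R * (B + B).
Proof.
move=> [_ _ _ cinj] cw da ca cB.
apply/ler_addgt0Pr => e e0.
have [n n0 /le_trans] := integral_norm_derive_le_variation da ca e0; apply.
rewrite lerD2r; apply: variation_le_multiplicity => //.
  exact: is_derive_continuous da.
move=> v; apply: card_le_trans (cw v).
set S := [set u | _].
have Sinj : {in S &, injective c}.
  move=> s t /set_mem[s01 _] /set_mem[t01 _]; apply: cinj; by rewrite inE/= in_itv.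
have /card_eqPle[_ /card_le_trans] := inj_card_eq Sinj; apply.
by apply: subset_card_le => _ [u [_ cu] <-]; split => //; exists u.
Qed.

Lemma curve_lengthE (c : R -> R * R) (a b : R -> R) :
  (forall u : R, is_derive u 1 (fst \o c) (a u)) ->
  (forall u : R, is_derive u 1 (snd \o c) (b u)) -> continuous a -> continuous b ->
  curve_length c = (\int[mu]_(u in `[0, 1]) Num.sqrt (a u ^+ 2 + b u ^+ 2))%:E.
Proof.
move=> da db ca cb.
have cE : c^`()%classic = (fun u => (a u, b u)).
  apply/funext => v; rewrite derive1E.
  by have [_ ->] : is_derive v 1 c (a v, b v) by apply/is_derive_pairP.
rewrite /curve_length /speed cE /Rintegral fineK//.
apply: integrable_fin_num; first exact: measurable_itv.
apply: continuous_integrable01 => u.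
apply: (@continuous_comp _ _ _ (fun v => a v ^+ 2 + b v ^+ 2)); last first.
  exact: sqrt_continuous.
by apply: cvgD; apply: cvgM; (exact: ca || exact: cb).
Qed.

Lemma csf_solution_length_le (w : nat) (B tau t : R) (c : R -> R * R)
    (X : R -> R -> R * R) :
  csf_solution c tau X -> omega_graph w c ->
  (forall u, `|(c u).1| <= B) -> (forall u, `|(c u).2| <= B) -> 0 < t < tau ->
  (curve_length (X t) <=
   ((w%:R * (B + B) + 1) + (B + 1) ^+ 2 * (w%:R * (B + B) + 1) / t)%:E)%E.
Proof.
move=> sol cw c1 c2 tD.
have tD' : 0 <= t < tau by case/andP: tD => /ltW ->.
have D0 : 0 <= (0 : R) < tau.
  by rewrite lexx; case/andP: tD; exact: lt_trans.
have [x [xu [xuu [xt [xtu [y [yu [yuu [yt [ytu [csf XE]]]]]]]]]]] :=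
  csf_solution_coordinates sol.
have [_ X0 _ scc _] := sol.
have B0 : 0 <= B by rewrite (le_trans _ (c1 0)).
have fstX s : 0 <= s < tau -> fst \o X s = x s.
  by move=> sD; apply/funext => u /=; rewrite XE.
have sndX s : 0 <= s < tau -> snd \o X s = y s.
  by move=> sD; apply/funext => u /=; rewrite XE.
have dx s (u : R) : 0 <= s < tau -> is_derive u 1 (fst \o X s) (xu s u).
  by move=> sD; rewrite fstX//; exact: family_u (csf_x csf) _ _ sD.
have dy s (u : R) : 0 <= s < tau -> is_derive u 1 (snd \o X s) (yu s u).
  by move=> sD; rewrite sndX//; exact: family_u (csf_y csf) _ _ sD.
have cxu s : 0 <= s < tau -> continuous (xu s).
  by move=> sD; apply: is_derive_continuous => u; exact: family_uu (csf_x csf) _ _ sD.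
have cyu s : 0 <= s < tau -> continuous (yu s).
  by move=> sD; apply: is_derive_continuous => u; exact: family_uu (csf_y csf) _ _ sD.
rewrite (curve_lengthE (fun u => dx t u tD') (fun u => dy t u tD')
  (cxu t tD') (cyu t tD')).
rewrite lee_fin; apply: (csf_length_le csf) => //.
- by rewrite ltr_wpDl// mulr_ge0// addr_ge0.
- by move=> u; have := c2 u; rewrite -X0 XE.
- apply: (@le_trans _ _ (w%:R * (B + B))); last by rewrite lerDl.
  apply: (@horizontal_variation_omega_graph w B c).
  + by rewrite -X0; exact: scc.
  + by [].
  + by move=> u; rewrite -X0; exact: dx.
  + exact: cxu.
  + by [].
Qed.

End LengthBound.

(** * Uniform bounds for the approximations *)

Section UniformBound.
Context {R : realType}.
Implicit Types (A B T : set (R * R)) (M : R).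

Definition coord_bounded A M := forall p, A p -> `|p.1| <= M /\ `|p.2| <= M.

Lemma smooth_curve_continuous (c : R -> R * R) : smooth_curve c -> continuous c.
Proof.
by move=> sc u; apply/differentiable_continuous/derivable1_diffP/(sc 0%N u).
Qed.

Lemma smooth_closed_curve_bounded (c : R -> R * R) : smooth_closed_curve c ->
  exists M, coord_bounded (range c) M.
Proof.
move=> [sc _ per _]; have cc := smooth_curve_continuous sc.
have [M1 H1] : exists M, forall u, `|(c u).1| <= M.
  apply: periodic_continuous_bounded => [u|u]; last by rewrite per.
  by apply: (cvg_comp _ _ (cc u)); exact: cvg_fst.
have [M2 H2] : exists M, forall u, `|(c u).2| <= M.
  apply: periodic_continuous_bounded => [u|u]; last by rewrite per.
  by apply: (cvg_comp _ _ (cc u)); exact: cvg_snd.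
exists (Num.max M1 M2) => _ [u _ <-].
by rewrite !le_max H1 H2 orbT.
Qed.

Lemma topologist_sine_curve_bounded T : topologist_sine_curve T ->
  exists M, coord_bounded T M.
Proof.
move=> [b [s [b0 [ss _ _ _ _] ->]]].
have : compact (s @` `[0, 1]).
  apply: continuous_compact; last exact: segment_compact.
  by apply: continuous_subspaceT; exact: smooth_curve_continuous.
move=> /compact_bounded[M [_ /(_ (M + 1))]]; rewrite ltrDl ltr01 => /(_ isT) H.
exists (Num.max (M + 1) (Num.max b 1)) => p [[[x]|]|].
- rewrite /= in_itv/= => /andP[x0 xb] <- /=; split.
    by rewrite !le_max (gtr0_norm x0) (ltW xb) orbT.
  have sin1 : `|sin x^-1| <= 1 by rewrite ler_norml sin_geN1 sin_le1.
  by rewrite !le_max sin1 !orbT.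
- move=> [-> p2]; have {}p2 : `|p.2| <= 1 by rewrite ler_norml.
  by rewrite normr0 !le_max ler01 p2 !orbT.
- move=> /H /=; rewrite prod_normE/= ge_max => /andP[h1 h2].
  by rewrite !le_max h1 h2.
Qed.

Lemma coord_le_eucl_norm (p : R * R) : `|p.1| <= eucl_norm p /\ `|p.2| <= eucl_norm p.
Proof.
by rewrite /eucl_norm -!sqrtr_sqr; split; rewrite ler_wsqrtr// ?lerDl ?lerDr sqr_ge0.
Qed.

Lemma hausdorff_dist_coord_bounded A B M : (hausdorff_dist A B < 1%:E)%E ->
  coord_bounded B M -> coord_bounded A (M + 1).
Proof.
rewrite /hausdorff_dist gt_max => /andP[AB _] Bb p Ap.
have : (ereal_inf [set (eucl_dist p q)%:E | q in B] < 1%:E)%E.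
  by apply: le_lt_trans AB; apply: ereal_sup_ubound; exists p.
move=> /ereal_inf_lt[_ [q Bq <-]]; rewrite lte_fin => pq.
have [q1 q2] := Bb q Bq; have [d1 d2] := coord_le_eucl_norm (p - q).
split.
  rewrite -[p.1](subrK q.1) addrC (le_trans (ler_normD _ _))// lerD//.
  exact: le_trans d1 (ltW pq).
rewrite -[p.2](subrK q.2) addrC (le_trans (ler_normD _ _))// lerD//.
exact: le_trans d2 (ltW pq).
Qed.

(** All but finitely many curves lie within distance 1 of the bounded set [T], and each remaining
    one is bounded by compactness. *)
Lemma allowable_uniformly_bounded (gamma : nat -> R -> R * R) T :
  topologist_sine_curve T -> allowable gamma T ->
  exists M, forall n, coord_bounded (range (gamma n)) M.
Proof.
move=> /topologist_sine_curve_bounded[M TM] [sg dist _ _].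
have [m Hm] := choice (fun n => smooth_closed_curve_bounded (sg n)).
have : \forall n \near \oo, (hausdorff_dist (range (gamma n)) T < 1%:E)%E.
  by apply: (dist [set x | (x < 1%:E)%E]); apply: open_ereal_lt'; rewrite lte_fin.
move=> [N _ HN].
(* The sum dominates the individual bound of each of the first [N] curves. *)
exists (Num.max (M + 1) (\sum_(i < N) `|m i|)) => n p np.
have [nN|Nn] := ltnP n N.
  have [h1 h2] := Hm n p np.
  have mN : m n <= \sum_(i < N) `|m i|.
    rewrite (bigD1 (Ordinal nN))//= (le_trans (ler_norm _))// lerDl.
    by apply: sumr_ge0.
  by rewrite !le_max (le_trans h1 mN) (le_trans h2 mN) !orbT.
have [h1 h2] := hausdorff_dist_coord_bounded (HN n Nn) TM np.
by rewrite !le_max h1 h2.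
Qed.

End UniformBound.

Theorem corollary1p5 (R : realType) (T : set (R * R))
    (gamma : nat -> R -> R * R) (tau : nat -> R)
    (flow : nat -> R -> R -> R * R) :
  topologist_sine_curve T ->
  allowable_inside gamma T \/ allowable_outside gamma T ->
  (forall n : nat, csf_evolution (gamma n) (tau n) (flow n)) ->
  forall t : R, (0 < t)%R ->
    (ereal_sup (range (fun n : nat => evolution_length (tau n) (flow n) t))
       < +oo)%E.
Proof.
move=> Tsine allow evol t t0.
have {}allow : allowable gamma T by case: allow => -[].
have [B HB] := allowable_uniformly_bounded Tsine allow.
have [_ _ _ [w _ gw]] := allow.
have B0 : 0 <= B by have [/(le_trans (normr_ge0 _))] := HB 0 _ (imageT (gamma 0) 0).
(* The added 1 keeps [C] positive even when [B = 0]. *)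
set C := w%:R * (B + B) + 1.
have C0 : 0 <= C by rewrite addr_ge0// mulr_ge0// addr_ge0.
apply: (@le_lt_trans _ _ (C + (B + 1) ^+ 2 * C / t)%:E); last exact: ltry.
apply: ge_ereal_sup => _ [n _ <-]; rewrite /evolution_length.
case: ifPn => [tn|_].
  apply: csf_solution_length_le (evol n).1 (gw n) _ _ _.
  - by move=> u; have [] := HB n _ (imageT (gamma n) u).
  - by move=> u; have [] := HB n _ (imageT (gamma n) u).
  - by rewrite t0.
by rewrite lee_fin addr_ge0// divr_ge0 ?(ltW t0)// mulr_ge0// exprn_ge0// addr_ge0.
Qed.
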